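(* If $G$ is a Hamiltonian outerplanar graph with $n$ vertices, then $$D_2(G) < c\log n + 9,\qquad\text{where } c=\frac{12}{\log(3/2)}+1<22.$$
   Context: All graphs are finite simple graphs. A graph is regarded as a structure with one anti-reflexive symmetric binary relation $E$ (adjacency). First-order formulas are over the vocabulary $\{E,=\}$, with connectives $\neg,\wedge,\vee$ and quantifiers $\exists,\forall$. The quantifier rank of a formula is the maximum number of nested quantifiers in it. For a formula $\Phi$, its set of sequences of nested quantifiers $\mathrm{nest}(\Phi)$ (words over $\{\exists,\forall\}$) is defined inductively: - $\mathrm{nest}(\Phi)=\{\text{empty word}\}$ for atomic $\Phi$; - $\mathrm{nest}(\neg\Phi)$ is $\mathrm{nest}(\Phi)$ with $\exists$ and $\forall$ interchanged in every word; - $\mathrm{nest}(\Phi\wedge\Psi)=\mathrm{nest}(\Phi\vee\Psi)=\mathrm{nest}(\Phi)\cup\mathrm{nest}(\Psi)$; - $\mathrm{nest}(\exists x\Phi)=\exists\,\mathrm{nest}(\Phi)$ and $\mathrm{nest}(\forall x\Phi)=\forall\,\mathrm{nest}(\Phi)$. The alternation number of $\Phi$ is the maximum, over words $s\in\mathrm{nest}(\Phi)$, of the number of occurrences of $\exists\forall$ and $\forall\exists$ in $s$. A closed formula $\Phi$ defines $G$ if $\Phi$ is true on $G$ and false on every graph not isomorphic to $G$. $D_k(G)$ is the minimum quantifier rank of a formula with alternation number at most $k$ defining $G$. An outerplanar graph is a planar graph embeddable in the plane with all vertices on the boundary of one face. A graph is Hamiltonian if it has a cycle through all its vertices. $\log$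 is to base 2. *)

(* Defs.v *)
From HB Require Import structures.
From mathcomp Require Import all_boot all_order all_algebra.
From mathcomp Require Import all_classical all_reals all_analysis.
Set Implicit Arguments.
Unset Strict Implicit.
Unset Printing Implicit Defensive.
Import Order.TTheory GRing.Theory Num.Theory.
Import numFieldNormedType.Exports.

Record graph := Graph {
  vertex :> finType;
  adj : rel vertex;
  adj_sym : symmetric adj;
  adj_irrefl : irreflexive adj }.

Definition isomorphic (G H : graph) : Prop :=
  exists f : G -> H, bijective f /\ {mono f : x y / adj x y}.

(* [2 < size c] excludes the degenerate closed walks x, y, x of length 2, which
   [ucycle] accepts. *)
Definition hamiltonian (G : graph) : Prop :=
  exists c : seq G,
    [/\ ucycle (@adj G) c, (2 < size c)%N & forall x, x \in c].

(* [formula n] has its free variables among 'I_n (de Bruijn indices): a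
   quantifier binds index [ord0] of its body and shifts the other variables by
   [lift ord0].  Closed formulas are exactly those of type [formula 0]. *)
Inductive formula : nat -> Type :=
| FEq n (i j : 'I_n) : formula n
| FAdj n (i j : 'I_n) : formula n
| FNot n (p : formula n) : formula n
| FAnd n (p q : formula n) : formula n
| FOr n (p q : formula n) : formula n
| FEx n (p : formula n.+1) : formula n
| FAll n (p : formula n.+1) : formula n.

Definition sentence := formula 0.

Definition scons n (T : Type) (x : T) (e : 'I_n -> T) : 'I_n.+1 -> T :=
  fun i => oapp e x (unlift ord0 i).

Fixpoint sat (G : graph) n (p : formula n) : ('I_n -> G) -> bool :=
  match p in formula n return ('I_n -> G) -> bool with
  | FEq _ i j => fun e => e i == e j
  | FAdj _ i j => fun e => adj (e i) (e j)
  | FNot _ p => fun e => ~~ sat p e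
  | FAnd _ p q => fun e => sat p e && sat q e
  | FOr _ p q => fun e => sat p e || sat q e
  | FEx _ p => fun e => [exists x : G, sat p (scons x e)]
  | FAll _ p => fun e => [forall x : G, sat p (scons x e)]
  end.

Definition env0 (T : Type) : 'I_0 -> T :=
  fun i => False_rect T (notF (ltn_ord i)).

Definition models (G : graph) (p : sentence) : bool := sat p (@env0 G).

Fixpoint qrank n (p : formula n) : nat :=
  match p with
  | FEq _ _ _ | FAdj _ _ _ => 0
  | FNot _ p => qrank p
  | FAnd _ p q | FOr _ p q => maxn (qrank p) (qrank q)
  | FEx _ p | FAll _ p => (qrank p).+1
  end.

(* Words over {exists, forall}: [true] stands for the existential quantifier and
   [false] for the universal one; a finite set of words is given by a list. *)
Fixpoint nest n (p : formula n) : seq (seq bool) :=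
  match p with
  | FEq _ _ _ | FAdj _ _ _ => [:: [::]]
  | FNot _ p => [seq map negb s | s <- nest p]
  | FAnd _ p q | FOr _ p q => nest p ++ nest q
  | FEx _ p => [seq true :: s | s <- nest p]
  | FAll _ p => [seq false :: s | s <- nest p]
  end.

Fixpoint alternations (s : seq bool) : nat :=
  match s with
  | a :: ((b :: _) as s') => ((a != b) + alternations s')%N
  | _ => 0
  end.

Definition alternation_number n (p : formula n) : nat :=
  \max_(s <- nest p) alternations s.

Definition defines (p : sentence) (G : graph) : Prop :=
  models G p /\ forall H : graph, ~ isomorphic G H -> ~~ models H p.

Definition definable_with (k : nat) (G : graph) (d : nat) : Prop :=
  exists p : sentence,
    [/\ (alternation_number p <= k)%N, defines p G & qrank p = d].

(* Every finite graph is defined by a sentence of alternation number 0, so that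
   the minimum in the definition of D_k(G) exists. *)
Section Definability.

Fixpoint exs k : formula k -> sentence :=
  match k with
  | 0 => fun p => p
  | k'.+1 => fun p => exs (FEx p)
  end.

Definition bigand (I : Type) n (r : seq I) (f : I -> formula n.+1) :=
  foldr (fun i => FAnd (f i)) (FEq ord0 ord0) r.

Lemma sat_ext (G : graph) n (p : formula n) (e e' : 'I_n -> G) :
  e =1 e' -> sat p e = sat p e'.
Proof. by move=> /funext ->. Qed.

Lemma modelsN (G : graph) (p : sentence) : models G (FNot p) = ~~ models G p.
Proof. by []. Qed.

Lemma modelsA (G : graph) (p q : sentence) :
  models G (FAnd p q) = models G p && models G q.
Proof. by []. Qed.

Lemma sat_exs (G : graph) k (p : formula k) :
  models G (exs p) <-> exists e : 'I_k -> G, sat p e.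
Proof.
elim: k p => [|k IH] p /=.
  split=> [h|[e h]]; first by exists (@env0 G).
  by rewrite /models (sat_ext p (e := @env0 G) (e' := e)) // => -[].
rewrite IH; split=> [[e /existsP[x h]]|[e h]]; first by exists (scons x e).
exists (fun i => e (lift ord0 i)); apply/existsP; exists (e ord0).
apply: etrans h; apply: sat_ext => i; rewrite /scons.
by case: unliftP => [j|] ->.
Qed.

Lemma sat_bigand (G : graph) (I : eqType) n (r : seq I) (f : I -> formula n.+1)
    (e : 'I_n.+1 -> G) :
  sat (bigand r f) e = all (fun i => sat (f i) e) r.
Proof. by elim: r => [|i r IH] /=; rewrite ?eqxx // IH. Qed.

Lemma nest_exs k (p : formula k) :
  nest (exs p) = [seq nseq k true ++ s | s <- nest p].
Proof.
elim: k p => [|k IH] p /=; first by rewrite map_id.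
rewrite IH /= -map_comp; apply: eq_map => s /=.
by rewrite -cat1s catA cats1 -[in RHS]cat_cons; congr (_ ++ _); elim: k {IH p} => //= k ->.
Qed.

Lemma alternations_nseq k b : alternations (nseq k b) = 0.
Proof. by elim: k => [|[|k] IH] //=; rewrite eqxx. Qed.

Definition flat n (p : formula n) := all (pred1 [::]) (nest p).

Lemma flat_bigand (I : Type) n (r : seq I) (f : I -> formula n.+1) :
  (forall i, flat (f i)) -> flat (bigand r f).
Proof.
move=> fl; elim: r => [|i r IH] //.
by rewrite /flat /= all_cat; apply/andP; split; [exact: fl | exact: IH].
Qed.

Lemma nest_exs_flat k (p : formula k) :
  flat p -> all (pred1 (nseq k true)) (nest (exs p)).
Proof.
move=> fl; rewrite nest_exs all_map; apply: sub_all fl => s /= /eqP ->.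
by rewrite cats0.
Qed.

Definition pairs k : seq ('I_k * 'I_k) := enum [set: 'I_k * 'I_k]%SET.

Definition distinct_formula k : formula k.+1 :=
  bigand (pairs k.+1)
    (fun ij => if ij.1 == ij.2 then FEq ij.1 ij.1 else FNot (FEq ij.1 ij.2)).

Definition diagram (G : graph) k (v : 'I_k.+1 -> G) : formula k.+1 :=
  bigand (pairs k.+1)
    (fun ij => if adj (v ij.1) (v ij.2) then FAdj ij.1 ij.2
               else FNot (FAdj ij.1 ij.2)).

Lemma sat_distinct (G : graph) k (e : 'I_k.+1 -> G) :
  sat (distinct_formula k) e <-> injective e.
Proof.
rewrite sat_bigand; split=> [/allP h i j eij|inj].
  have := h (i, j); rewrite mem_enum inE /= => /(_ isT).
  by case: eqP => // _ /=; rewrite eij eqxx.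
apply/allP => -[i j] _ /=; case: eqP => [_|/eqP ne] /=; first exact: eqxx.
by rewrite (inj_eq inj).
Qed.

Lemma sat_diagram (G H : graph) k (v : 'I_k.+1 -> G) (e : 'I_k.+1 -> H) :
  sat (diagram v) e <-> forall i j, adj (e i) (e j) = adj (v i) (v j).
Proof.
rewrite sat_bigand; split=> [/allP h i j|h].
  have := h (i, j); rewrite mem_enum inE /= => /(_ isT).
  by case: (adj (v i) (v j)) => /= [|/negbTE].
apply/allP => -[i j] _ /=; case: ifP => /= hv; first by rewrite h hv.
by rewrite h hv.
Qed.

Lemma models_more (G : graph) k :
  models G (exs (distinct_formula k)) = (k < #|G|)%N.
Proof.
apply/idP/idP => [/sat_exs[e /sat_distinct inj]|lt].
  by have := leq_card e inj; rewrite card_ord.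
apply/sat_exs; exists (fun i => enum_val (widen_ord lt i)).
by apply/sat_distinct => i j /enum_val_inj /(congr1 val) /= /val_inj.
Qed.

Lemma flat_distinct k : flat (distinct_formula k).
Proof. by apply: flat_bigand => ij; case: ifP. Qed.

Lemma flat_diagram (G : graph) k (v : 'I_k.+1 -> G) : flat (diagram v).
Proof. by apply: flat_bigand => ij; case: ifP. Qed.

Lemma alternations_neg k (p : sentence) :
  all (pred1 (nseq k true)) (nest p) ->
  forall s, s \in nest (FNot p) -> alternations s = 0.
Proof.
move=> /allP h s /= /mapP[t /h /eqP -> ->].
by rewrite map_nseq alternations_nseq.
Qed.

Lemma definable k (G : graph) : exists d, `[< definable_with k G d >].
Proof.
suff [p ap dp] : exists2 p : sentence,
    (forall s, s \in nest p -> alternations s = 0) & defines p G.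
  exists (qrank p); apply/asboolP; exists p; split => //.
  rewrite /alternation_number big_seq big1 // => s /ap ->.
have [n0|] := posnP #|G|.
  exists (FNot (exs (distinct_formula 0))).
    exact/alternations_neg/nest_exs_flat/flat_distinct.
  split=> [|H nGH]; rewrite modelsN models_more ?n0 // negbK lt0n.
  apply/negP => /eqP H0; apply: nGH.
  have noG (x : G) : False by have /card0_eq/(_ x) := n0; rewrite inE.
  exists (fun x => False_rect H (noG x)); split; last by move=> x; case: (noG x).
  by apply: inj_card_bij => [x|]; [case: (noG x) | rewrite n0 H0].
case En : #|G| => [//|n] _.
pose v (i : 'I_n.+1) : G := enum_val (cast_ord (esym En) i).
pose w (x : G) : 'I_n.+1 := cast_ord En (enum_rank x).
have wK : cancel w v by move=> x; rewrite /v /w cast_ordK enum_rankK.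
have vK : cancel v w by move=> i; rewrite /v /w enum_valK cast_ordKV.
exists (FAnd (exs (FAnd (distinct_formula n) (diagram v)))
             (FNot (exs (distinct_formula n.+1)))).
  move=> s; rewrite /= mem_cat => /orP[].
    have /nest_exs_flat/allP h : flat (FAnd (distinct_formula n) (diagram v)).
      by rewrite /flat /= all_cat; apply/andP; split;
        [exact: flat_distinct | exact: flat_diagram].
    by move=> /h /eqP ->; rewrite alternations_nseq.
  exact: (alternations_neg (nest_exs_flat (flat_distinct n.+1))).
split=> [|H nGH]; rewrite modelsA modelsN models_more.
  rewrite En ltnn andbT; apply/sat_exs; exists v => /=.
  by apply/andP; split; [apply/sat_distinct/(can_inj vK)|apply/sat_diagram].
apply/negP => /andP[/sat_exs[e /= /andP[/sat_distinct inj /sat_diagram he]]].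
rewrite -leqNgt => leH; apply: nGH; exists (e \o w); split=> [|x y] /=.
  apply: inj_card_bij; first exact: inj_comp inj (can_inj wK).
  by rewrite En.
by rewrite he !wK.
Qed.

End Definability.

Definition D (k : nat) (G : graph) : nat := ex_minn (definable k G).

Section Plane.
Local Open Scope classical_set_scope.
Local Open Scope ring_scope.
Variable R : realType.

Definition is_arc (p q : R * R) (A : set (R * R)) : Prop :=
  exists g : R -> R * R,
    [/\ {within `[0, 1], continuous g},
        {in `[0, 1] &, injective g},
        g 0 = p, g 1 = q & A = g @` `[0, 1]].

Definition boundary (A : set (R * R)) : set (R * R) :=
  closure A `&` closure (~` A).

(* A drawing of G in the plane: [pos] places the vertices and [curve x y] is the
   point set of the edge xy; it is irrelevant when x and y are not adjacent. *)
Record plane_drawing (G : graph) (pos : G -> R * R)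
    (curve : G -> G -> set (R * R)) : Prop := PlaneDrawing {
  pos_inj : injective pos;
  curve_sym : forall x y, adj x y -> curve x y = curve y x;
  curve_arc : forall x y, adj x y -> is_arc (pos x) (pos y) (curve x y);
  curve_vertex : forall x y z,
    adj x y -> curve x y (pos z) -> z = x \/ z = y;
  curve_disjoint : forall x y x' y', adj x y -> adj x' y' ->
    [set x; y]%SET <> [set x'; y']%SET ->
    curve x y `&` curve x' y' `<=` range pos }.

Definition drawing_support (G : graph) (pos : G -> R * R)
    (curve : G -> G -> set (R * R)) : set (R * R) :=
  range pos `|` [set p | exists x y, adj x y /\ curve x y p].

Definition is_face (X F : set (R * R)) : Prop :=
  exists2 p, (~` X) p & F = connected_component (~` X) p.

Definition outerplanar (G : graph) : Prop :=
  exists pos curve, @plane_drawing G pos curve /\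
    exists2 F, is_face (drawing_support pos curve) F &
      forall x, boundary F (pos x).

Definition log2 (x : R) : R := ln x / ln 2.

End Plane.

(* Main.v *)
(* Two chords of the Hamiltonian cycle cannot cross: together with the cycle and
   a point of the face they would give a drawing of K5 in which edges without a
   common end are disjoint. Replacing arcs by chains of short steps, this is
   refuted by counting crossings modulo 2 (van Kampen's obstruction); since only
   chains are needed, neither accessibility of the boundary of the face nor the
   Jordan curve theorem is used.

   Noncrossing chords provide small separators: a connected set consisting of at
   most two arcs of the cycle is cut, by deleting at most nine vertices, into
   components of the same kind and of half the size.  A component of G minus the
   pebbled vertices is described, relatively to the pebbles, by pebbling one vertex
   in each of the components that remain after a deletion, describing these
   components recursively, and saying that the deleted vertex has no further
   neighbours.  The last clause is a forall-exists formula of rank about log n,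
   as joining paths are found by repeated halving, and all other quantifiers are
   existential, whence two alternations. *)
Require Import Defs.
From mathcomp Require Import all_boot all_order all_algebra.
From mathcomp Require Import all_classical all_reals all_analysis.
From mathcomp Require Import zify lra.
Set Implicit Arguments.
Unset Strict Implicit.
Unset Printing Implicit Defensive.
Import Order.TTheory GRing.Theory Num.Theory.
Import numFieldNormedType.Exports.

(** * The parity obstruction for K5 *)

(** The rank of the sentence is the number of pebbles placed along one branch of the recursion, plus
    the rank of the closing clause. The components left by a deletion are described side by side in
    a conjunction, at the price of the dearest one, but they are pebbled together: the pebbles keep
    the images of isomorphic components apart. A deletion therefore costs as many quantifiers as it
    leaves components. Planarity alone does not bound this number; counting arcs of the Hamiltonian
    cycle amortizes it. Halving costs at most 19, and the joining paths add 1 to the coefficient of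
    the logarithm. The resulting 20 fits below the constant of the statement because 19 <= 12 /
    log(3/2), that is, (3/2)^19 <= 2^12. *)

Section Winding.
Variable R : realType.
Local Open Scope ring_scope.
Implicit Types u v w p q : R * R.

(** The half-plane contains just one of its two boundary rays, so that exactly one of [u] and [- u]
    is upper when [u] is nonzero. *)
Definition upper u := (0 < u.2) || (u.2 == 0) && (0 < u.1).

(* The parity of the number of crossings of a chain of short steps with the
   positive horizontal half-axis plays the role of its winding number mod 2. *)
Definition crosses u w := (upper u != upper w) && (0 < u.1).

Lemma upperN u : u != 0 -> upper (- u) = ~~ upper u.
Proof.
case: u => x y; rewrite /upper /= -[_ == 0 :> R * R]/((x == 0) && (y == 0)).
rewrite oppr_eq0 !oppr_gt0.
by case: (ltgtP y 0) => //= _; case: (ltgtP x 0).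
Qed.

Lemma norm_pair_lt u r : (`|u| < r) = (`|u.1| < r) && (`|u.2| < r).
Proof. by rewrite [`|u|]prod_normE gt_max. Qed.

Lemma norm_pair_ge u r : (r <= `|u|) = (r <= `|u.1|) || (r <= `|u.2|).
Proof. by rewrite [`|u|]prod_normE le_max. Qed.

(* Two nearby vectors far from 0 on opposite sides of the horizontal axis are
   nearly horizontal. *)
Lemma upper_neq_far u w r :
  r <= `|u| -> `|u - w| < r -> upper u != upper w -> r <= `|u.1|.
Proof.
case: u w => [x y] [x' y']; rewrite norm_pair_ge norm_pair_lt /upper /=.
rewrite !ler_normr !ltr_norml.
case/orP=> // hy /andP[hx hyy] hne; exfalso.
have : (0 <= y /\ y' <= 0) \/ (y <= 0 /\ 0 <= y').
  move: hne; case: (ltgtP y 0) => hy0; case: (ltgtP y' 0) => hy0' //=; lra.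
move: hyy hy => /andP[h1 h2] /orP[] h3 [[h4 h5]|[h4 h5]]; lra.
Qed.

(** Where the axis is crossed the abscissa is at least [r] in absolute value, and a displacement
    below [r] keeps its sign. Hence [crosses] may test the abscissa of either end of a short
    step. *)
Lemma same_side u v w r : r <= `|u| -> `|u - w| < r -> `|u - v| < r ->
  upper u != upper w -> (0 < v.1) = (0 < u.1).
Proof.
move=> hu huw huv /(upper_neq_far hu huw).
move: huv; rewrite norm_pair_lt /= => /andP[+ _].
rewrite ler_normr ltr_norml => /andP[h1 h2] h3; have r0 : 0 < r by lra.
by apply/idP/idP => h; case/orP: h3 => h3; lra.
Qed.

Definition close_far r u w := r <= `|u| /\ `|u - w| < r.

(** A small quadrilateral away from 0 does not wind around 0: either its corners lie on one side of
    the axis, or one of them is across from [u1], all abscissas have the same sign, and the sum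
    telescopes. *)
Lemma crosses_cycle r u1 u2 u3 u4 :
  (forall u w, u \in [:: u1; u2; u3; u4] -> w \in [:: u1; u2; u3; u4] ->
     close_far r u w) ->
  crosses u1 u2 (+) crosses u3 u4 = crosses u1 u4 (+) crosses u2 u3.
Proof.
move=> H.
have S u v w : u \in [:: u1; u2; u3; u4] -> w \in [:: u1; u2; u3; u4] ->
    v \in [:: u1; u2; u3; u4] -> upper u != upper w -> (0 < v.1) = (0 < u.1).
  move=> hu hw hv; have [h1 h2] := H _ _ hu hw; have [_ h3] := H _ _ hu hv.
  exact: same_side h1 h2 h3.
have i1 : u1 \in [:: u1; u2; u3; u4] by rewrite !inE eqxx.
have i2 : u2 \in [:: u1; u2; u3; u4] by rewrite !inE eqxx !orbT.
have i3 : u3 \in [:: u1; u2; u3; u4] by rewrite !inE eqxx !orbT.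
have i4 : u4 \in [:: u1; u2; u3; u4] by rewrite !inE eqxx !orbT.
have [[h2 h3 h4]|[e2 e3 e4]] :
    [/\ upper u1 = upper u2, upper u1 = upper u3 & upper u1 = upper u4] \/
    [/\ (0 < u2.1) = (0 < u1.1), (0 < u3.1) = (0 < u1.1)
      & (0 < u4.1) = (0 < u1.1)].
- case: (eqVneq (upper u1) (upper u2)) => h2; last first.
    by right; split; apply: S h2.
  case: (eqVneq (upper u1) (upper u3)) => h3; last first.
    by right; split; apply: S h3.
  case: (eqVneq (upper u1) (upper u4)) => h4; last first.
    by right; split; apply: S h4.
  by left.
- by rewrite /crosses -h2 -h3 -h4 !eqxx.
rewrite /crosses e2 e3; case: (0 < u1.1); rewrite ?andbF // !andbT.
by case: (upper u1); case: (upper u2); case: (upper u3); case: (upper u4).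
Qed.

(** A step across the horizontal axis meets exactly one of the two half-axes, and negation exchanges
    them. *)
Lemma crossesN r u w : close_far r u w -> close_far r w u ->
  crosses u w (+) crosses (- u) (- w) = upper u (+) upper w.
Proof.
move=> [hu huw] [hw _]; rewrite /crosses.
have r0 : 0 < r by apply: le_lt_trans huw.
have u0 : u != 0 by rewrite -normr_gt0 (lt_le_trans r0 hu).
have w0 : w != 0 by rewrite -normr_gt0 (lt_le_trans r0 hw).
rewrite !upperN //.
case: (boolP (upper u == upper w)) => [/eqP->|h]; first by rewrite eqxx addbb.
have := lt_le_trans r0 (upper_neq_far hu huw h).
have -> : upper u (+) upper w by case: (upper u) h; case: (upper w).
have -> /= : (~~ upper u != ~~ upper w) by case: (upper u) h; case: (upper w).
by rewrite normr_gt0 oppr_gt0; case: (ltgtP 0 u.1).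
Qed.

(** The degenerate last pair gives a step even to a chain reduced to a point, and makes the end of a
    chain comparable with the steps of another one. *)
Fixpoint steps p (s : seq (R * R)) :=
  if s is q :: s' then (p, q) :: steps q s' else [:: (p, p)].

Lemma steps_head p s : exists q, (p, q) \in steps p s.
Proof. by case: s => [|q s]; [exists p|exists q]; rewrite inE eqxx. Qed.

Lemma steps_last p s : (last p s, last p s) \in steps p s.
Proof.
by elim: s p => [|q s IH] p /=; rewrite ?inE ?eqxx ?IH ?orbT.
Qed.

(** The four differences between an end of one step and an end of the other are then at least [r] in
    norm and less than [r] apart, as [crosses_cycle] requires. *)
Definition far_apart (e f : (R * R) * (R * R)) := exists r,
  [/\ `|e.1 - e.2| + `|f.1 - f.2| < r, r <= `|e.1 - f.1|, r <= `|e.1 - f.2|,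
      r <= `|e.2 - f.1| & r <= `|e.2 - f.2|].

Fixpoint winding (g : R * R -> R * R) p (s : seq (R * R)) :=
  if s is q :: s' then crosses (g p) (g q) (+) winding g q s' else false.

Lemma far_apart_cell p p' q q' : far_apart (p, p') (q, q') ->
  exists r, forall u w, u \in [:: q - p; q' - p; q' - p'; q - p'] ->
    w \in [:: q - p; q' - p; q' - p'; q - p'] -> close_far r u w.
Proof.
move=> [r [/= h h1 h2 h3 h4]]; exists r.
have d0 : 0 <= `|p - p'| by []. have d1 : 0 <= `|q - q'| by [].
have e (a b c d : R * R) : a - b - (c - d) = (d - b) + (a - c).
  by rewrite opprB addrC addrACA (addrC (- c)) addrACA.
have hp : `|p' - p| = `|p - p'| by rewrite distrC.
have hq : `|q' - q| = `|q - q'| by rewrite distrC.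
move=> u w; rewrite !inE => /or4P[] /eqP -> /or4P[] /eqP ->;
  (split; [by rewrite distrC|rewrite e; apply: le_lt_trans (ler_normD _ _) _;
    rewrite ?(subrr, normr0, hp, hq); lra]).
Qed.

Lemma winding_strip p p' c t :
  (forall f, f \in steps c t -> far_apart (p, p') f) ->
  winding (fun q => q - p) c t (+) winding (fun q => q - p') c t
  = crosses (c - p) (c - p') (+) crosses (last c t - p) (last c t - p').
Proof.
elim: t c => [|q t IH] c /= H; first by rewrite addbb.
have /far_apart_cell[r C] := H (c, q) (mem_head _ _).
have E := crosses_cycle C.
rewrite addbACA IH => [|f hf]; last by apply: H; rewrite inE hf orbT.
have sym : crosses (q - p') (c - p') = crosses (c - p') (q - p').
  have [_ [h3 h4]] : close_far r (q - p') (c - p') /\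
    close_far r (c - p') (q - p').
    by split; apply: C; rewrite !inE eqxx ?orbT.
  rewrite /crosses eq_sym; case: eqVneq => //= h.
  by rewrite (same_side h3 h4 h4 h).
move: E; rewrite sym.
case: (crosses (c - p) (q - p)); case: (crosses (c - p') (q - p'));
  case: (crosses (c - p) (c - p')); case: (crosses (q - p) (q - p')) => //=;
  by case: (crosses (last q t - p) _).
Qed.

(** Subtraction maps the product of the two chains to a grid of small cells away from 0. No cell
    winds around 0, so neither does the boundary of the grid; [winding_strip] is one row. *)
Lemma winding_square a s c t :
  (forall e f, e \in steps a s -> f \in steps c t -> far_apart e f) ->
  winding (fun q => q - a) c t (+) winding (fun q => q - last a s) c t
  = winding (fun p => c - p) a s (+) winding (fun p => last c t - p) a s.
Proof.
elim: s a => [|b s IH] a H /=; first by rewrite !addbb.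
have := winding_strip (fun f => H (a, b) f (mem_head _ _)).
have := IH b (fun e f he => H e f (@mem_behead _ (_ :: _) _ he)).
by rewrite addbACA => <- <-; rewrite addbA addbK.
Qed.

Lemma winding_opp v a s :
  (forall e, e \in steps a s -> exists f, far_apart e (v, f)) ->
  winding (fun p => v - p) a s (+) winding (fun p => p - v) a s
  = upper (v - a) (+) upper (v - last a s).
Proof.
elim: s a => [|b s IH] a H /=; first by rewrite addbb.
have [f /far_apart_cell[r C]] := H (a, b) (mem_head _ _).
rewrite addbACA IH => [|e he]; last by apply: H; rewrite inE he orbT.
rewrite -!(opprB v) (@crossesN r) ?addbA ?addbK //.
  by apply: C; rewrite !inE eqxx ?orbT.
by apply: C; rewrite !inE eqxx ?orbT.
Qed.

(** Two sides of the square in [winding_square] are reversed by [winding_opp], so that all four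
    become windings of one chain around an end of the other. The reversal leaves the signs on the
    right, which depend on the ends only. *)
Lemma winding_pair a s c t :
  (forall e f, e \in steps a s -> f \in steps c t -> far_apart e f) ->
  let b := last a s in let d := last c t in
  let n v := winding (fun p => p - v) in
  n a c t (+) n b c t (+) n c a s (+) n d a s
  = upper (c - a) (+) upper (c - b) (+) upper (d - a) (+) upper (d - b).
Proof.
move=> H b d n; have := winding_square H.
have [q hq] := steps_head c t.
have := @winding_opp c a s (fun e he => ex_intro _ q (H e _ he hq)).
have := @winding_opp d a s (fun e he => ex_intro _ d (H e _ he (steps_last c t))).
rewrite -/(n a c t) -/(n b c t) -/(n c a s) -/(n d a s) -/b -/d.
move: (winding _ a s) (winding _ a s) => x y.
move: (n a c t) (n b c t) (n c a s) (n d a s) => n1 n2 n3 n4.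
move: (upper (c - a)) (upper (c - b)) (upper (d - a)) (upper (d - b)).
by case: n1; case: n2; case: n3; case: n4; case: x; case: y => [] [] [] [] [].
Qed.

(* Van Kampen's parity argument: each winding number [n v ij] occurs in exactly
   two of the fifteen equations, whereas each of the five quadruples of vertices
   contributes an odd number of signs. *)
Lemma K5_parity (n : nat -> nat -> nat -> bool) (h : nat -> nat -> bool) :
  (forall i j, (i < 5)%N -> (j < 5)%N -> i != j -> h i j = ~~ h j i) ->
  ~ (forall i j k l, (i < j < 5)%N -> (k < l < 5)%N ->
       [&& i != k, i != l, j != k & j != l] ->
       n i k l (+) n j k l (+) n k i j (+) n l i j
       = h k i (+) h k j (+) h l i (+) h l j).
Proof.
move=> ha E.
pose b i j k : nat := n i j k.
(* Adding the equations of the three pairs of opposite edges, the signs [h j i], [h k i] and [h l i]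
   occur twice, while each of the pairs jk, jl, kl occurs in both orders and contributes 1. *)
have Q i j k l : (i < j)%N -> (j < k)%N -> (k < l)%N -> (l < 5)%N ->
  odd (b i k l + b j k l + b k i j + b l i j + b i j l + b k j l + b j i k
    + b l i k + b i j k + b l j k + b j i l + b k i l).
  move=> ij jk kl l5; rewrite !oddD !oddb.
  have := E i j k l; have := E i k j l; have := E i l j k.
  have := ha j k; have := ha j l; have := ha k l.
  have -> : (i < j < 5)%N by lia.
  have -> : (i < k < 5)%N by lia.
  have -> : (i < l < 5)%N by lia.
  have -> : (j < k < 5)%N by lia.
  have -> : (j < l < 5)%N by lia.
  have -> : (k < l < 5)%N by lia.
  have -> : (j < 5)%N by lia.
  have -> : (k < 5)%N by lia.
  rewrite l5; have -> : j != k by lia.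
  have -> : j != l by lia.
  have -> : k != l by lia.
  have -> : i != j by lia.
  have -> : i != k by lia.
  have -> : i != l by lia.
  have -> : k != j by lia.
  have -> : l != j by lia.
  have -> : l != k by lia.
  move=> /(_ isT isT isT) e1 /(_ isT isT isT) e2 /(_ isT isT isT) e3.
  move=> /(_ isT isT isT) E3 /(_ isT isT isT) E2 /(_ isT isT isT) E1.
  have A x x1 x2 x3 x4 : x (+) x1 (+) x2 (+) x3 (+) x4
    = x (+) (x1 (+) x2 (+) x3 (+) x4) by rewrite !addbA.
  rewrite [X in X (+) _ (+) _ (+) _ (+) _]A A E1 E2 E3 e1 e2 e3.
  by case: (h k i); case: (h l i); case: (h j i); case: (h k j);
    case: (h l j); case: (h l k).
have := Q 0 1 2 3 isT isT isT isT; have := Q 0 1 2 4 isT isT isT isT.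
have := Q 0 1 3 4 isT isT isT isT; have := Q 0 2 3 4 isT isT isT isT.
have := Q 1 2 3 4 isT isT isT isT; clearbody b; clear; lia.
Qed.

Lemma K5_not_far_apart (v : nat -> R * R) (s : nat -> nat -> seq (R * R)) :
  (forall i j, (i < 5)%N -> (j < 5)%N -> i != j -> v i != v j) ->
  (forall i j, (i < j < 5)%N -> last (v i) (s i j) = v j) ->
  ~ (forall i j k l, (i < j < 5)%N -> (k < l < 5)%N ->
       [&& i != k, i != l, j != k & j != l] ->
       forall e f, e \in steps (v i) (s i j) -> f \in steps (v k) (s k l) ->
       far_apart e f).
Proof.
move=> vinj hlast H.
apply: (@K5_parity (fun i k l => winding (fun p => p - v i) (v k) (s k l))
                   (fun i j => upper (v i - v j))).
  by move=> i j i5 j5 ij; rewrite -opprB upperN // subr_eq0 vinj // eq_sym.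
move=> i j k l ij kl ijkl.
by have := winding_pair (H i j k l ij kl ijkl); rewrite /= !hlast.
Qed.

End Winding.

(** * Chains of short steps in connected sets *)

Section Chains.
Variable R : realType.
Local Open Scope ring_scope.
Local Open Scope classical_set_scope.
Implicit Types p q r u : R * R.

Definition chain (P : R * R -> R * R -> Prop) p q :=
  exists2 s, last p s = q & forall e, e \in steps p s -> P e.1 e.2.

Lemma chain_cat P p q r : chain P p q -> chain P q r -> chain P p r.
Proof.
move=> [s <- hs] [t <- ht]; exists (s ++ t); first by rewrite last_cat.
elim: s p hs ht => [|x s IH] p //= hs ht e.
rewrite inE => /orP[/eqP->|]; first exact/hs/mem_head.
by apply: IH => // f hf; apply: hs; rewrite inE hf orbT.
Qed.

Lemma chain_step P p q : P p q -> P q q -> chain P p q.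
Proof. by move=> h h'; exists [:: q] => //= e; rewrite !inE => /orP[] /eqP->. Qed.

Lemma chain_sub (P Q : R * R -> R * R -> Prop) p q :
  (forall u w, P u w -> Q u w) -> chain P p q -> chain Q p q.
Proof. by move=> PQ [s ls hs]; exists s => // e /hs /PQ. Qed.

(** The points reached from [p] form a subset that is open and closed in [A]; for this, steps
    between nearby points are allowed in both directions. *)
Lemma connected_chain (A : set (R * R)) (P : R * R -> R * R -> Prop) :
  connected A ->
  (forall p, A p -> \forall q \near p, A q -> P p q /\ P q p) ->
  forall p q, A p -> A q -> chain P p q.
Proof.
move=> cA hP p q Ap Aq.
have Pxx x : A x -> P x x by move=> Ax; have /nbhs_singleton/(_ Ax)[] := hP x Ax.
pose B := A `&` [set x | chain P p x].
suff : B = A by move=> E; move: Aq; rewrite -E => -[].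
pose near_set x := [set y | A y -> P x y /\ P y x].
have opn (D : set (R * R)) : open (\bigcup_(x in A `&` D) (near_set x)^°).
  by apply: bigcup_open => x _; exact: open_interior.
have self (D : set (R * R)) x : A x -> D x ->
    (\bigcup_(x in A `&` D) (near_set x)^°) x.
  by move=> Ax Dx; exists x => //; exact: hP.
apply: cA.
- by exists p; split=> //; exists [::] => // e; rewrite inE => /eqP-> /=;
  exact: Pxx.
- exists (\bigcup_(x in A `&` [set x | chain P p x]) (near_set x)^°) => //.
  apply/seteqP; split=> x [Ax]; first by move=> px; split=> //; exact: self.
  move=> [y [Ay py] /interior_subset/(_ Ax)[yx _]]; split => //=.
  by apply: chain_cat py (chain_step yx (Pxx _ Ax)).
- exists (~` \bigcup_(x in A `&` ~` [set x | chain P p x]) (near_set x)^°).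
    exact/open_closedC.
  apply/seteqP; split=> x [Ax].
    move=> px; split=> // -[y [Ay npy] /interior_subset/(_ Ax)[_ xy]]; apply: npy.
    by apply: chain_cat px (chain_step xy (Pxx _ Ay)).
  by move=> h; split=> //; apply: contrapT => npx; apply: h; exact: self.
Qed.

(** The differences [p - q] form a compact set, which misses 0. *)
Lemma compact_separation (A B : set (R * R)) : compact A -> compact B ->
  A `&` B = set0 -> exists2 r, 0 < r & forall p q, A p -> B q -> r <= `|p - q|.
Proof.
move=> cA cB AB0.
pose f (x : (R * R) * (R * R)) := x.1 - x.2.
have cf : compact (f @` (A `*` B)).
  apply: continuous_compact; last exact: compact_setX.
  apply: continuous_subspaceT => x.
  apply: (@cvgB _ _ _ (nbhs x) _ fst snd); [exact: cvg_fst|exact: cvg_snd].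
have := closed_openC (compact_closed (@norm_hausdorff _ _) cf).
rewrite openE => /(_ 0) h.
have /h/nbhs_normP[r /= r0 hr] : (~` (f @` (A `*` B))) 0.
  move=> [[p q] [Ap Bq] /eqP]; rewrite subr_eq0 => /eqP /= pq.
  have : (A `&` B) p by split=> //; rewrite pq.
  by rewrite AB0.
exists r => // p q Ap Bq; rewrite leNgt; apply/negP => pqr.
apply: (hr (p - q)); first by rewrite /= sub0r normrN.
by exists (p, q).
Qed.

Lemma seq_uniform (T : eqType) (l : seq T) (Q : R -> T -> Prop) :
  (forall t d d', 0 < d <= d' -> Q d' t -> Q d t) ->
  (forall t, t \in l -> exists2 d, 0 < d & Q d t) ->
  exists2 d, 0 < d & forall t, t \in l -> Q d t.
Proof.
move=> mon; elim: l => [|t l IH] h; first by exists 1.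
have [d d0 hd] := h t (mem_head _ _).
have [|d' d'0 hd'] := IH; first by move=> x xl; apply: h; rewrite inE xl orbT.
exists (Num.min d d'); first by rewrite lt_min d0.
move=> x; rewrite inE => /orP[/eqP->|/hd' hx].
  by apply: mon hd; rewrite lt_min d0 d'0 ge_min lexx.
by apply: mon hx; rewrite lt_min d0 d'0 ge_min lexx orbT.
Qed.

Lemma fin_uniform (T : finType) (Q : R -> T -> Prop) :
  (forall t d d', 0 < d <= d' -> Q d' t -> Q d t) ->
  (forall t, exists2 d, 0 < d & Q d t) -> exists2 d, 0 < d & forall t, Q d t.
Proof.
move=> mon h; have [//|d d0 hd] := @seq_uniform _ (enum T) Q mon.
by exists d => // t; apply: hd; rewrite mem_enum.
Qed.

Lemma is_arc_compact p q A : is_arc p q A -> compact A.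
Proof.
by move=> [g [cg _ _ _ ->]]; apply: continuous_compact => //;
  exact: segment_compact.
Qed.

Lemma is_arc_chain p q A d : is_arc p q A -> 0 < d ->
  chain (fun u w => [/\ `|u - w| < d, A u & A w]) p q.
Proof.
move=> [g [cg _ g0 g1 AE]] d0.
have Ap : A p by rewrite AE -g0; exists 0 => //=; rewrite in_itv /= lexx ler01.
have Aq : A q by rewrite AE -g1; exists 1 => //=; rewrite in_itv /= lexx ler01.
apply: (connected_chain (A := A)) => //.
  rewrite AE; apply: connected_continuous_connected => //.
  exact: segment_connected.
move=> u Au; apply/nbhs_normP; exists d => //= w /= uw Aw; split; split=> //.
by rewrite distrC.
Qed.

End Chains.

(** * From a plane drawing to far apart chains *)

Section Drawing.
Variable R : realType.
Local Open Scope ring_scope.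
Local Open Scope classical_set_scope.
Variables (G : graph) (pos : G -> R * R) (curve : G -> G -> set (R * R)).
Hypothesis drawing : plane_drawing pos curve.
Implicit Types (x y a : G) (u w z p q : R * R) (W : {set G}).

Lemma curve_compact x y : adj x y -> compact (curve x y).
Proof. by move=> /(curve_arc drawing)/is_arc_compact. Qed.

Lemma curves_apart : exists2 r, 0 < r & forall x y x' y',
  adj x y -> adj x' y' -> [&& x' != x, x' != y, y' != x & y' != y] ->
  forall u w, curve x y u -> curve x' y' w -> r <= `|u - w|.
Proof.
pose Q d (t : (G * G) * (G * G)) :=
  adj t.1.1 t.1.2 -> adj t.2.1 t.2.2 ->
  [&& t.2.1 != t.1.1, t.2.1 != t.1.2, t.2.2 != t.1.1 & t.2.2 != t.1.2] ->
  forall u w, curve t.1.1 t.1.2 u -> curve t.2.1 t.2.2 w -> d <= `|u - w|.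
have [||r r0 h] := @fin_uniform R _ Q; last first.
- by exists r => // x y x' y'; exact: h ((x, y), (x', y')).
- move=> [[x y] [x' y']]; rewrite /Q /=.
  case: (boolP (adj x y)) => [xy|_]; last by exists 1.
  case: (boolP (adj x' y')) => [xy'|_]; last by exists 1.
  case: (boolP [&& _, _, _ & _]) => [/and4P[h1 h2 h3 h4]|_]; last by exists 1.
  have [|r r0 h] := compact_separation (curve_compact xy) (curve_compact xy').
    apply/seteqP; split=> // u [cu cu'].
    have [|z _ zu] := curve_disjoint drawing xy xy' _ (conj cu cu').
      move=> /setP/(_ x'); rewrite !inE eqxx (negbTE h1) (negbTE h2).
      by [].
    move: cu cu'; rewrite -zu => /(curve_vertex drawing xy) + /(curve_vertex
      drawing xy').
    by move=> [] -> [] E; move: h1 h2 h3 h4; rewrite E eqxx.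
  by exists r.
- move=> t d d' /andP[d0 dd'] h xy xy' D u w cu cw.
  exact: le_trans dd' (h xy xy' D u w cu cw).
Qed.

Lemma point_apart p (P : G -> G -> bool) :
  (forall x y, P x y -> adj x y /\ ~ curve x y p) ->
  exists2 r, 0 < r & forall x y, P x y -> forall u, curve x y u -> r <= `|p - u|.
Proof.
move=> hP.
pose Q d (t : G * G) := P t.1 t.2 -> forall u, curve t.1 t.2 u -> d <= `|p - u|.
have [||r r0 h] := @fin_uniform R _ Q; last first.
- by exists r => // x y; exact: h (x, y).
- move=> [x y]; rewrite /Q /=.
  case: (boolP (P x y)) => [/hP[xy npc]|_]; last by exists 1.
  have [|r r0 h] := compact_separation (@compact_set1 _ p) (curve_compact xy).
    by apply/seteqP; split=> // u [-> cu].
  by exists r => // _ u; exact: h.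
- by move=> t d d' /andP[d0 dd'] h pt u cu; exact: le_trans dd' (h pt u cu).
Qed.

(* A step which is shorter, by a margin [d], than its distance to the edges
   avoiding [a]. *)
Definition spoke a d u w := exists2 r, `|u - w| + d <= r & forall x y,
  adj x y -> a != x -> a != y -> forall z, curve x y z ->
  r <= `|u - z| /\ r <= `|w - z|.

Lemma spoke_le a d d' u w : d <= d' -> spoke a d' u w -> spoke a d u w.
Proof. by move=> dd' [r h h']; exists r => //; apply: le_trans h;
  rewrite lerD2l. Qed.

(** Inside the face, steps are kept short compared with the distance to the drawing. The boundary
    point is then reached by one jump from a nearby point of the face. This jump may pass across
    edges at [a], but it is short compared with the distance [r0] to the edges avoiding [a].
    Finiteness of the chain makes the margin uniform. *)
Lemma spoke_chain F p a : is_face (drawing_support pos curve) F -> F p ->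
  boundary F (pos a) -> exists2 d, 0 < d & chain (spoke a d) p (pos a).
Proof.
move=> [p0 _ FE] Fp [clF _].
have cF : connected F by rewrite FE; exact: component_connected.
have FX u : F u -> ~ drawing_support pos curve u.
  by rewrite FE => /connected_component_sub.
move=> {FE}; suff [s ls hs] : chain (fun u w => exists2 d,
  0 < d & spoke a d u w) p (pos a).
  pose Q d (e : (R * R) * (R * R)) := spoke a d e.1 e.2.
  have mon e d d' : 0 < d <= d' -> Q d' e -> Q d e.
    by move=> /andP[_ dd']; exact: spoke_le.
  have [d d0 hd] := seq_uniform mon hs.
  by exists d => //; exists s.
have [|r0 r00 hr] := @point_apart (pos a) (fun x y => [&& adj x y,
  a != x & a != y]).
  move=> x y /and3P[xy ax ay]; split=> // /(curve_vertex drawing xy)[] E.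
    by move: ax; rewrite E eqxx.
  by move: ay; rewrite E eqxx.
have tri u w z : `|u - z| <= `|u - w| + `|w - z|.
  by rewrite -[u - z](subrKA w) ler_normD.
have [|q [Fq /= aq]] := clF (ball (pos a) (r0 / 4)). apply: nbhsx_ballx; lra.
move: aq; rewrite -ball_normE /= => aq.
apply: (@chain_cat _ _ _ q).
  apply: connected_chain cF _ _ _ Fp Fq => u Fu.
  (* All edges are at distance at least [r] from [u]: a step below [r / 4] keeps both ends at
     distance [r / 2], with margin [r / 4]. *)
  have [|r rp hu] := @point_apart u (fun x y => adj x y).
    move=> x y xy; split=> // cu; apply: (FX u Fu); by right; exists x, y.
  apply/nbhs_normP; exists (r / 4) => /=; first lra.
  move=> w /= uw _.
  have near u' w' : `|u' - w'| < r / 4 ->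
      (forall x y z, adj x y -> curve x y z -> r / 2 <= `|u' - z| /\
        r / 2 <= `|w' - z|) ->
      exists2 d, 0 < d & spoke a d u' w'.
    move=> h h'; exists (r / 4); first lra.
    by exists (r / 2); [lra|move=> x y xy _ _ z; exact: h'].
  split; apply: near; rewrite // 1?distrC // => x y z xy cz;
    by have h1 := hu x y xy z cz; have h2 := tri u w z; split; lra.
have r4 : 0 < r0 / 4 by lra.
apply: chain_step; (exists (r0 / 4); [done|]); exists (r0 / 2);
  rewrite ?(distrC q) ?subrr ?normr0; try lra;
  move=> x y xy ax ay z cz; (have /hr/(_ z cz) h1 : [&& adj x y, a != x & a != y]
    by rewrite xy ax ay); have h2 := tri (pos a) q z; split; lra.
Qed.

Definition road W d u w := `|u - w| < d /\
  exists x y, [/\ x \in W, y \in W, adj x y, curve x y u & curve x y w].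

(** Even the degenerate last step must lie on an edge, which a walk without edges does not supply;
    hence [s != [::]]. *)
Lemma road_chain W d x s : 0 < d -> path (@adj G) x s -> s != [::] ->
  {subset x :: s <= W} -> chain (road W d) (pos x) (pos (last x s)).
Proof.
move=> d0; elim: s x => [//|y s IH] x /= /andP[xy ys] _ sub.
have xW : x \in W by apply: sub; rewrite inE eqxx.
have yW : y \in W by apply: sub; rewrite !inE eqxx orbT.
have hxy : chain (road W d) (pos x) (pos y).
  apply: chain_sub (is_arc_chain (curve_arc drawing xy) d0) => u w [h cu cw].
  by split=> //; exists x, y.
case: s IH ys sub => [//|z s] IH ys sub.
apply: chain_cat hxy (IH _ ys isT _) => t ts; apply: sub.
by rewrite inE ts orbT.
Qed.

(** A point [p] of the face serves as the fifth vertex of K5. Only chains without a common end must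
    be far apart: a spoke to [w i] and a path avoiding [w i], or two paths with disjoint
    supports. *)
Lemma no_outer_K4 F (w : nat -> G) (W : nat -> nat -> {set G})
    (s : nat -> nat -> seq G) :
  is_face (drawing_support pos curve) F ->
  (forall x, boundary F (pos x)) ->
  (forall i j, (0 < i < j)%N -> (j < 5)%N -> w i != w j) ->
  (forall i j, (0 < i < j)%N -> (j < 5)%N ->
     [/\ path (@adj G) (w i) (s i j), last (w i) (s i j) = w j
       & {subset w i :: s i j <= W i j}]) ->
  (forall i j k, (0 < i < j)%N -> (j < 5)%N -> (0 < k < 5)%N ->
     k != i -> k != j -> w k \notin W i j) ->
  ~ (forall i j k l, (0 < i < j)%N -> (j < 5)%N -> (0 < k < l)%N -> (l < 5)%N ->
     [&& i != k, i != l, j != k & j != l] ->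
     forall x, x \in W i j -> x \notin W k l).
Proof.
move=> hF bF winj hs hW disj.
have [p Fp] : exists p, F p.
  by move: hF => [p hp ->]; exists p; exact: connected_component_refl.
have [d d0 hd] : exists2 d, 0 < d & forall i, i \in iota 1 4 ->
    chain (spoke (w i) d) p (pos (w i)).
  apply: (@seq_uniform _ _ _ (fun d i => chain (spoke (w i) d) p (pos (w i)))).
    move=> i d d' /andP[_ dd']; apply: chain_sub => u v; exact: spoke_le.
  by move=> i _; exact: spoke_chain hF Fp (bF _).
have [r r0 hr] := curves_apart.
(* Road steps below [d] fit into the margin of the spokes; two road steps below [r / 2] have total
   length less than the distance [r] between disjoint edges. *)
pose d1 := Num.min d (r / 2).
have d10 : 0 < d1 by rewrite lt_min d0 divr_gt0.
have [d1d d1r] : d1 <= d /\ d1 <= r / 2.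
  by rewrite /d1 !ge_min !lexx orbT.
pose v i := if i == 0%N then p else pos (w i).
have chains (ij : nat * nat) : exists t, (ij.1 < ij.2 < 5)%N ->
    last (v ij.1) t = v ij.2 /\ forall e, e \in steps (v ij.1) t ->
      if ij.1 == 0%N then spoke (w ij.2) d e.1 e.2
      else road (W ij.1 ij.2) d1 e.1 e.2.
  case: ij => i j /=; case: (boolP (i < j < 5)%N) => [/andP[ij j5]|_]; last first.
    by exists [::].
  case: i ij => [|i] ij.
    have [|t lt ht] := hd j; first by rewrite mem_iota ij.
    by exists t => _; split=> //; rewrite lt /v; case: j ij {j5 lt ht}.
  have [P L S] := hs i.+1 j ij j5.
  have ne : s i.+1 j != [::].
    by apply/eqP => E; move: L; rewrite E /=; apply/eqP/winj.
  have [t lt ht] := road_chain d10 P ne S.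
  by exists t => _; split=> //; rewrite /v lt L; case: j ij {j5 P L S ne lt ht}.
have {chains} [t ht] := choice chains.
apply: (@K5_not_far_apart R v (fun i j => t (i, j))).
- have pw i : p != pos (w i).
    apply/eqP => E; move: hF Fp => [q _ ->] /connected_component_sub; apply.
    by left; exists (w i).
  case=> [|i] [|j] i5 j5 /=; rewrite ?eqxx // => ij; rewrite /v /=.
  - exact: pw.
  - by rewrite eq_sym pw.
  rewrite (inj_eq (pos_inj drawing)).
  case: (ltngtP i j) ij => [h _|h _|->]; rewrite ?eqxx //.
    exact: winj.
  by rewrite eq_sym; apply: winj.
- by move=> i j ij; have [] := ht (i, j) ij.
- have spoke_road i j k e f : (0 < j < k)%N -> (k < 5)%N -> (0 < i < 5)%N ->
      i != j -> i != k -> spoke (w i) d e.1 e.2 -> road (W j k) d1 f.1 f.2 ->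
      far_apart e f.
    move=> jk k5 i5 ij ik [a ha ha'] [hf [x [y [xW yW xy cx cy]]]].
    have iW := hW j k i jk k5 i5 ij ik.
    have wx : w i != x by apply: contraNneq iW => ->.
    have wy : w i != y by apply: contraNneq iW => ->.
    have [h1 h2] := ha' _ _ xy wx wy _ cx; have [h3 h4] := ha' _ _ xy wx wy _ cy.
    exists a; split=> //; lra.
  have sym e f : far_apart e f -> far_apart f e.
    move=> [a [h1 h2 h3 h4 h5]]; exists a.
    by split; [rewrite addrC|rewrite distrC..].
  move=> i j k l ij kl; have [_ hi] := ht (i, j) ij; have [_ hk] := ht (k, l) kl.
  move=> /and4P[ik il jk jl] e f he hf.
  move: {hi hk} (hi e he) (hk f hf) => /=.
  case: (eqVneq i 0%N) => [i0|i0]; case: (eqVneq k 0%N) => [k0|k0] hi hk.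
  - by move: ik; rewrite i0 k0.
  - by apply: spoke_road hi hk => //; lia.
  - by apply: sym; apply: spoke_road hk hi; rewrite ?(eq_sym l) //; lia.
  have := disj i j k l; rewrite ik il jk jl.
  have -> : (0 < i < j)%N by lia. have -> : (j < 5)%N by lia.
  have -> : (0 < k < l)%N by lia. have -> : (l < 5)%N by lia.
  move=> /(_ isT isT isT isT isT) dis.
  move: hi hk => [he1 [x [y [xW yW xy cx cy]]]] [hf1 [x' [y' [xW' yW' xy' cx'
    cy']]]].
  have ne (z z' : G) : z \in W i j -> z' \in W k l -> z' != z.
    by move=> h; apply: contraTneq => ->; exact: dis.
  have D : [&& x' != x, x' != y, y' != x & y' != y] by rewrite !ne.
  by exists r; split; [lra|exact: hr xy xy' D _ _ _ _ ..].
Qed.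

End Drawing.

(* Gives the lemmas on finite sets precedence over those on classical sets. *)
Import mathcomp.boot.fintype mathcomp.boot.finset.

(** * Chords of a Hamiltonian cycle *)

(* [at_ i] is the [i]-th vertex of a Hamiltonian cycle, indices being taken
   modulo [n]. *)
Record cycle_labelling (G : graph) (n : nat) (at_ : nat -> G) (pos : G -> nat) :=
  CycleLabelling {
    lab_adj : forall i, adj (at_ i) (at_ i.+1);
    lab_atK : forall i, pos (at_ i) = i %% n;
    lab_posK : forall x, at_ (pos x) = x;
    lab_lt : forall x, pos x < n }.

Lemma hamiltonian_labelling (G : graph) : hamiltonian G ->
  exists at_ pos, @cycle_labelling G #|G| at_ pos.
Proof.
move=> [c [/andP[cyc uc] sc hc]].
have cE : size c = #|G|.
  by rewrite -(card_uniqP uc); apply: eq_card => x; rewrite !inE hc.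
have [x0 _] : exists x0, x0 \in c by case: c sc {cyc uc hc cE} => // x; exists x;
  rewrite inE eqxx.
have n0 : 0 < #|G| by rewrite -cE; apply: leq_trans sc.
exists (fun i => nth x0 c (i %% #|G|)), (fun x => index x c); split.
- move=> i; have lt : i %% #|G| < size c by rewrite cE ltn_pmod.
  rewrite -[i.+1]addn1 -modnDml addn1 -cE; move: lt; rewrite -cE.
  move: (i %% size c) => {}i lt.
  case: c cyc lt {uc sc hc cE n0} => [//|x p] /(pathP x0) /= P lt.
  have := P i; rewrite size_rcons => /(_ lt).
  rewrite -rcons_cons nth_rcons /= lt nth_rcons.
  have -> : nth x0 (x :: p) (i.+1 %% (size p).+1)
          = if i < size p then nth x0 p i else x.
    case: ltnP => ip; first by rewrite modn_small.
    have -> : i = size p by lia.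
    by rewrite modnn.
  case: ltnP => // ip; have -> : i = size p by lia.
  by rewrite eqxx.
- by move=> i; rewrite index_uniq // cE ltn_pmod.
- by move=> x; rewrite modn_small ?nth_index // -cE index_mem.
- by move=> x; rewrite -cE index_mem.
Qed.

Section Noncrossing.
Variables (G : graph) (n : nat) (at_ : nat -> G) (pos : G -> nat).
Hypothesis lab : cycle_labelling n at_ pos.

Lemma at_path i m : path (@adj G) (at_ i) [seq at_ k | k <- iota i.+1 m].
Proof. by elim: m i => //= m IH i; rewrite (lab_adj lab) IH. Qed.

Lemma at_last i m : last (at_ i) [seq at_ k | k <- iota i.+1 m] = at_ (i + m).
Proof. by elim: m i => [|m IH] i /=; rewrite ?addn0 // IH addSnnS. Qed.

Lemma at_mod i : at_ i = at_ (i %% n).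
Proof. by rewrite -(lab_atK lab) (lab_posK lab). Qed.

Lemma at_small i : i < n -> pos (at_ i) = i.
Proof. by move=> h; rewrite (lab_atK lab) modn_small. Qed.

Lemma rev_walk (x y : G) s (W : pred G) :
  [/\ path (@adj G) x s, last x s = y & all W (x :: s)] ->
  exists t, [/\ path (@adj G) y t, last y t = x & all W (y :: t)].
Proof.
move=> [P <- A]; exists (rev (belast x s)); split.
- by rewrite rev_path; apply: etrans P; apply: eq_path => u v; rewrite adj_sym.
- by case: s {P A} => //= z s; rewrite rev_cons last_rcons.
- by rewrite -rev_rcons -lastI all_rev.
Qed.

(** The cycle and two crossing chords form a subdivision of K4 with branch vertices at [a], [b],
    [c], [d], and all vertices lie on the boundary of the face. *)
Lemma noncrossing (R : realType) a b c d : outerplanar R G ->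
  a < b -> b < c -> c < d -> d < n ->
  adj (at_ a) (at_ c) -> adj (at_ b) (at_ d) -> False.
Proof.
move=> [ps [cv [dr [F hF bF]]]] ab bc cd dn ac bd.
(* Index 0 is a dummy: it is reserved for the point of the face. *)
pose w i := at_ (nth 0 [:: 0; a; b; c; d] i).
have pw i : i < 5 -> pos (w i) = nth 0 [:: 0; a; b; c; d] i.
  by move=> i5; apply: at_small; case: i i5 => [|[|[|[|[|i]]]]] //=; lia.
pose W i j := [set x | let p := pos x in
  match i, j with
  | 1, 2 => a <= p <= b
  | 2, 3 => b <= p <= c
  | 3, 4 => c <= p <= d
  | 1, 4 => (p <= a) || (d <= p)
  | 1, 3 => (p == a) || (p == c)
  | 2, 4 => (p == b) || (p == d)
  | _, _ => false
  end]%SET.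
have walk i m (P : pred G) : (forall k, i <= k <= i + m -> P (at_ k)) ->
    exists s, [/\ path (@adj G) (at_ i) s, last (at_ i) s = at_ (i + m)
      & all P (at_ i :: s)].
  move=> hP; exists [seq at_ k | k <- iota i.+1 m]; split.
  - exact: at_path.
  - exact: at_last.
  - apply/allP => x; rewrite inE => /orP[/eqP->|/mapP[k +  ->]].
      by apply: hP; rewrite leqnn leq_addr.
    by rewrite mem_iota => h; apply: hP; lia.
have ex (ij : nat * nat) : exists s, 0 < ij.1 < ij.2 -> ij.2 < 5 ->
    [/\ path (@adj G) (w ij.1) s, last (w ij.1) s = w ij.2
       & all (mem (W ij.1 ij.2)) (w ij.1 :: s)].
  have edge x y i j : w i = x -> w j = y -> adj x y -> x \in W i j ->
    y \in W i j ->
     exists s, 0 < i < j -> j < 5 ->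
    [/\ path (@adj G) (w i) s, last (w i) s = w j & all (mem (W i j)) (w i :: s)].
    move=> -> -> xy xW yW; exists [:: y] => _ _; split=> //=; first by rewrite xy.
    by rewrite xW yW.
  case: ij => i j /=.
  have seg i' j' p q : w i' = at_ p -> w j' = at_ q -> p <= q ->
     (forall k, p <= k <= q -> at_ k \in W i' j') ->
     exists s, 0 < i' < j' -> j' < 5 ->
    [/\ path (@adj G) (w i') s, last (w i') s = w j' & all (mem (W i' j')) (w i'
      :: s)].
    move=> -> -> pq hP; have [|s] := walk p (q - p) (mem (W i' j')).
      by move=> k; rewrite subnKC //; apply: hP.
    by rewrite subnKC // => hs; exists s.
  case: i => [|[|[|[|i]]]]; case: j => [|[|[|[|[|j]]]]]; try (by exists [::]).
  - apply: (seg _ _ a b) => //; [lia|] => k h.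
    by rewrite inE /= at_small //; lia.
  - by apply: (edge (at_ a) (at_ c)) => //;
    rewrite inE /= at_small ?eqxx ?orbT //; lia.
  (* The remaining arc runs from [d] through the origin of the labelling to [n + a], and is then
     reversed. *)
  - have [|s hs] := walk d (n + a - d) (mem (W 1 4)).
      move=> k h; rewrite /= inE /= (lab_atK lab).
      case: (ltnP k n) => kn; first by rewrite modn_small //; lia.
      by rewrite -(subnK kn) modnDr modn_small; lia.
    have [|t ht] := @rev_walk (w 4) (w 1) s (mem (W 1 4)).
      move: hs; rewrite subnKC; last lia.
      by have -> : at_ (n + a) = at_ a by rewrite at_mod modnDl -at_mod.
    by exists t.
  - apply: (seg _ _ b c) => //; [lia|] => k h.
    by rewrite inE /= at_small //; lia.
  - by apply: (edge (at_ b) (at_ d)) => //;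
    rewrite inE /= at_small ?eqxx ?orbT //; lia.
  - apply: (seg _ _ c d) => //; [lia|] => k h.
    by rewrite inE /= at_small //; lia.
have [s hs] := choice ex.
apply: (no_outer_K4 dr hF bF (w := w) (W := W) (s := fun i j => s (i, j))).
- move=> i j ij j5; apply/eqP => /(congr1 pos); rewrite !pw //; last lia.
  by move: i j ij j5 => [|[|[|[|i]]]] [|[|[|[|[|j]]]]] //= _ _; lia.
- by move=> i j ij j5; have [h1 h2 /allP h3] := hs (i, j) ij j5; split.
- move=> i j k ij j5 k5 ki kj; rewrite inE /= pw; last lia.
  by move: i j k ij j5 k5 ki kj => [|[|[|[|i]]]] [|[|[|[|[|j]]]]]
    [|[|[|[|[|k]]]]] //= _ _ _ _ _; lia.
- move=> i j k l ij j5 kl l5 h x; rewrite !inE /=; move: (pos x) => p.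
  by move: i j k l ij j5 kl l5 h => [|[|[|[|i]]]] [|[|[|[|[|j]]]]]
    [|[|[|[|k]]]] [|[|[|[|[|l]]]]] //= _ _ _ _ _; lia.
Qed.
End Noncrossing.

(** * Dismantling by small separators *)

Section Components.
Variable G : graph.
Implicit Types (A B K T Y : {set G}) (x y u v : G).

Definition radj A : rel G := fun x y => [&& x \in A, y \in A & adj x y].

Definition component A x : {set G} := [set y | connect (radj A) x y].

Definition components A : {set {set G}} := [set component A x | x in A].

Definition ncomponents A : nat := #|components A|.

Lemma connect_radj_sym A : connect_sym (radj A).
Proof.
by apply: sym_connect_sym => x y; rewrite /radj adj_sym andbCA.
Qed.

Lemma connect_inv (e : rel G) (P : G -> Prop) x y :
  (forall u v, P u -> e u v -> P v) -> connect e x y -> P x -> P y.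
Proof.
move=> h /connectP[p + ->]; elim: p x => //= z p IH x /andP[xz zp] Px.
exact: IH zp (h _ _ Px xz).
Qed.

Lemma component_refl A x : x \in component A x.
Proof. by rewrite inE. Qed.

Lemma component_sub A x : x \in A -> component A x \subset A.
Proof.
move=> xA; apply/subsetP => y; rewrite inE => c.
by apply: (connect_inv (P := fun z => z \in A)) c xA => u v _ /and3P[].
Qed.

Lemma component_eq A x y : y \in component A x -> component A y = component A x.
Proof.
rewrite inE => xy; apply/setP => z; rewrite !inE.
exact/esym/(same_connect (@connect_radj_sym A)).
Qed.

Lemma components_component A K x : K \in components A -> x \in K ->
  K = component A x.
Proof. by move=> /imsetP[y _ ->] /component_eq ->. Qed.

Lemma components_sub A K : K \in components A -> K \subset A.
Proof. by move=> /imsetP[y yA ->]; exact: component_sub. Qed.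

Lemma components_ex A K : K \in components A -> exists x, x \in K.
Proof. by move=> /imsetP[y yA ->]; exists y; exact: component_refl. Qed.

Lemma components_adj A K x y : K \in components A -> x \in K -> y \in A ->
  adj x y -> y \in K.
Proof.
move=> KA xK yA xy; have xA := subsetP (components_sub KA) _ xK.
by rewrite (components_component KA xK) inE connect1 // /radj xA yA.
Qed.

Lemma components_mem A x : x \in A -> component A x \in components A.
Proof. exact: imset_f. Qed.

Lemma component_stable A B x : B \subset A -> x \in B ->
  (forall u v, u \in B -> u \in component A x -> v \in A -> adj u v -> v \in B) ->
  component A x = component B x.
Proof.
move=> BA xB h; apply/setP => y; rewrite !inE; apply/idP/idP.
  move=> c.
  suff H u v : u \in B /\ connect (radj B) x u -> radj A u v ->
      v \in B /\ connect (radj B) x v.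
    by have [] := connect_inv H c (conj xB (connect0 _ _)).
  move=> [uB xu] /and3P[uA vA uv].
  have vB : v \in B.
    apply: (h u) => //; rewrite inE;
      apply: connect_sub xu => s t /and3P[sB tB st].
    by rewrite connect1 // /radj st !(subsetP BA).
  split=> //; apply: connect_trans xu (connect1 _).
  by rewrite /radj uB vB.
apply: connect_sub => s t /and3P[sB tB st].
by rewrite connect1 // /radj st !(subsetP BA).
Qed.

Lemma components_restrict A B K : K \in components A -> K \subset B ->
  B \subset A ->
  K \in components B.
Proof.
move=> KA KB BA; have [x xK] := components_ex KA.
have xB := subsetP KB _ xK.
rewrite (components_component KA xK) (component_stable BA xB) ?components_mem //
  => u v _.
rewrite -(components_component KA xK) => uK vA uv.
by apply: (subsetP KB); exact: components_adj KA uK vA uv.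
Qed.

Lemma components_setD A K T K' : K \in components A ->
  K' \in components (K :\: T) ->
  K' \in components (A :\: T).
Proof.
move=> KA /imsetP[x xKT ->].
have sub : K :\: T \subset A :\: T by apply: setSD; exact: components_sub.
rewrite -(component_stable sub xKT).
  by apply: components_mem; apply: (subsetP sub).
move=> u v; rewrite !inE => /andP[_ uK] _ /andP[-> vA] uv /=.
exact: components_adj KA uK vA uv.
Qed.

Lemma components_in_closed A K Y y : K \in components A -> y \in K -> y \in Y ->
  (forall u v, u \in A -> v \in A -> adj u v -> u \in Y -> v \in Y) ->
    K \subset Y.
Proof.
move=> KA yK yY h; apply/subsetP => z.
rewrite (components_component KA yK) inE => c.
apply: (connect_inv (P := fun z => z \in Y)) c yY => u v uY /and3P[uA vA uv].
exact: h uv uY.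
Qed.

(* [elim K b]: a connected set [K] can be dismantled by deleting a vertex and
   recursively dismantling the components, at total cost [b] along every branch,
   where a deletion costs the number of components that it leaves. *)
Inductive elim : {set G} -> nat -> Prop :=
  Elim K x b c : x \in K -> (forall K', K' \in components (K :\ x) ->
    elim K' b) ->
    ncomponents (K :\ x) + b <= c -> elim K c.

Lemma elim_le K b c : elim K b -> b <= c -> elim K c.
Proof.
by case=> {K b} K x b b' xK h hb le; apply: Elim xK h (leq_trans hb le).
Qed.

Lemma elim_card1 K b : #|K| = 1 -> elim K b.
Proof.
move=> /eqP/cards1P[x ->]; apply: (@Elim _ x b) => //; rewrite ?inE // setDv.
  by move=> K'; rewrite /components imset0 inE.
by rewrite /ncomponents /components imset0 cards0.
Qed.

End Components.

(** * Arcs of the cycle and ladders between two arcs *)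

Section Bound.
Variables (G : graph) (n : nat) (at_ : nat -> G) (pos : G -> nat).
Hypothesis lab : cycle_labelling n at_ pos.
Hypothesis noncross : forall a b c d, a < b -> b < c -> c < d -> d < n ->
  adj (at_ a) (at_ c) -> adj (at_ b) (at_ d) -> False.
Implicit Types (A B K T Y : {set G}) (x y u v : G).

Let succ x := at_ (pos x).+1.

Lemma succ_adj x : adj x (succ x).
Proof. by rewrite -{1}(lab_posK lab x) (lab_adj lab). Qed.

Lemma pos_inj : injective pos.
Proof. exact: can_inj (lab_posK lab). Qed.

Lemma succ_inj : injective succ.
Proof.
move=> x y /(congr1 pos); rewrite !(lab_atK lab).
have := lab_lt lab x; have := lab_lt lab y => ly lx h; apply: pos_inj.
move: h; case: (ltnP (pos x).+1 n) => hx; case: (ltnP (pos y).+1 n) => hy.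
- by rewrite !modn_small // => -[].
- by have -> : (pos y).+1 = n by [lia]; rewrite modnn modn_small.
- by have -> : (pos x).+1 = n by [lia]; rewrite modnn modn_small.
- lia.
Qed.

(* The number of maximal arcs of the Hamiltonian cycle contained in [A]. *)
Definition arcs A := #|[set y in A | succ y \notin A]|.

(** The vertex of [K] with the largest index ends an arc. Without the hypothesis on [at_ 0], the
    whole cycle would be a set with no arc. *)
Lemma arcs_gt0 K x : x \in K -> at_ 0 \notin K -> 0 < arcs K.
Proof.
move=> xK n0; apply/card_gt0P.
have [y] := arg_maxnP pos (xK : (fun z => z \in K) x) => yK hy.
exists y; rewrite !inE yK /=.
apply/negP => sK; have /hy := sK; rewrite /succ (lab_atK lab).
case: (ltnP (pos y).+1 n) => h; first by (rewrite modn_small //=; lia).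
have E : (pos y).+1 = n by have := lab_lt lab y; lia.
by move: sK; rewrite /succ E (at_mod lab) modnn (negbTE n0).
Qed.

Lemma arcs_component A K : K \in components A ->
  arcs K = #|[set y in A | (succ y \notin A) && (component A y == K)]|.
Proof.
move=> KA; apply: eq_card => y; rewrite !inE.
apply/andP/and3P => [[yK sK]|[yA sA /eqP <-]]; last first.
  split; first exact: component_refl.
  by apply: contra sA; apply/subsetP/component_sub.
rewrite (subsetP (components_sub KA)) // -(components_component KA yK);
  split=> //.
by apply: contra sK => sA; exact: components_adj KA yK sA (succ_adj y).
Qed.

(** Consecutive vertices of the cycle are adjacent, so each arc lies in a single component. *)
Lemma sum_arcs A : \sum_(K in components A) arcs K = arcs A.
Proof.
rewrite /arcs -[RHS]sum1_card (partition_big (component A) (mem (components A)))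
  /=; last first.
  by move=> y; rewrite inE => /andP[yA _]; exact: components_mem.
apply: eq_bigr => K KA; rewrite -/(arcs K) (arcs_component KA) -sum1_card.
by apply: eq_bigl => y; rewrite !inE andbA.
Qed.

(** Every component other than [K] uses up at least one arc of [A]. *)
Lemma card_components_arcs A K : at_ 0 \notin A -> K \in components A ->
  ncomponents A + arcs K <= (arcs A).+1.
Proof.
move=> n0 KA; rewrite -(sum_arcs A) (bigD1 K) //= /ncomponents (cardsD1 K) KA.
suff : #|components A :\ K| <= \sum_(K' in components A | K' != K) arcs K'.
  by rewrite /= add1n addSn ltnS addnC leq_add2l.
rewrite -sum1_card (eq_bigl (fun K' => (K' \in components A) && (K' != K))).
  apply: leq_sum => K' /andP[K'A _]; have [x xK] := components_ex K'A.
  apply: arcs_gt0 xK _; apply: contra n0; apply/subsetP.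
  exact: components_sub.
by move=> K'; rewrite !inE andbC.
Qed.

Lemma card_components_le A : at_ 0 \notin A -> ncomponents A <= arcs A.
Proof.
move=> n0; case: (set_0Vmem (components A)) => [E|[K KA]];
  first by rewrite /ncomponents E cards0.
have [x xK] := components_ex KA; have := card_components_arcs n0 KA.
have : 0 < arcs K by apply: arcs_gt0 xK _; apply: contra n0;
  apply/subsetP/components_sub.
lia.
Qed.

(** The only vertex that can become the end of an arc is the predecessor of [x]. *)
Lemma arcs_setD1 A x : arcs (A :\ x) <= (arcs A).+1.
Proof.
rewrite /arcs; set S := [set y in A | _].
have le1 : #|[set y | succ y == x]| <= 1.
  by apply/card_le1_eqP => y z; rewrite !inE => /eqP <- /eqP/succ_inj.
rewrite -addn1; apply: leq_trans (leq_add (leqnn _) le1).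
apply: leq_trans (leq_card_setU _ _); apply/subset_leq_card/subsetP => y.
by rewrite !inE; case: (succ y == x); rewrite ?orbT //= => /andP[/andP[_ ->] ->].
Qed.

(* Deleting [k] vertices leaves at most [arcs K + k] arcs altogether, and every
   component contains one of them; hence the costs of the successive deletions
   along a branch add up to at most [arcs K + 2 k - 1]. *)
Lemma elim_phase b (ts : seq G) K : K \in components K -> at_ 0 \notin K ->
  (forall K', K' \in components (K :\: [set x in ts]) -> elim K' b) ->
  elim K (b + arcs K + 2 * size ts - 1).
Proof.
elim: ts K => [|t ts IH] K KK n0 h.
  have [x xK] := components_ex KK; have := arcs_gt0 xK n0 => r0.
  by apply: (@elim_le _ _ b); [apply: h; rewrite set_nil setD0|lia].
have [tK|tK] := boolP (t \in K); last first.
  apply: elim_le (IH K KK n0 _) _; last by rewrite /=; lia.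
  move=> K' hK'; apply: h; move: hK'; congr (_ \in components _).
  apply/setP => z; rewrite !inE; case: eqP => [->|//].
  by rewrite (negbTE tK) !andbF.
have n0' : at_ 0 \notin K :\ t by rewrite !inE (negbTE n0) andbF.
have le1 := card_components_le n0'; have le2 := arcs_setD1 K t.
(* The budget left once this deletion is paid; [le2] and [le3] show that it suffices for every
   component. *)
apply: (@Elim _ _ t (b + arcs K + 2 * (size ts).+1 - 1 - ncomponents (K :\ t)))
  => //;
  last by rewrite /=; lia.
move=> K' K'K; have le3 := card_components_arcs n0' K'K.
apply: elim_le (IH K' _ _ _) _; last by lia.
- exact: components_restrict K'K (subxx _) (components_sub K'K).
- by apply: contra n0'; exact: (subsetP (components_sub K'K)).
move=> K'' hK''; apply: h.
have -> : K :\: [set x in t :: ts] = (K :\ t) :\: [set x in ts].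
  by apply/setP => z; rewrite !inE negb_or -andbA andbCA.
exact: components_setD hK''.
Qed.

Definition intervals i1 i2 j1 j2 : {set G} :=
  [set x | (i1 <= pos x < i2) || (j1 <= pos x < j2)].

(** A vertex of [K] whose successor is outside [K] has its successor outside both intervals, so it
    is the last vertex of one of them; the subtracted boolean accounts for an empty second
    interval. *)
Lemma arcs_intervals i1 i2 j1 j2 K : i2 <= n -> j2 <= n ->
  K \in components (intervals i1 i2 j1 j2) -> arcs K <= 2 - (j2 <= j1).
Proof.
move=> i2n j2n KI.
have sub : [set y in K | succ y \notin K] \subset
    [set x in [seq at_ k | k <- i2.-1 :: (if j1 < j2 then [:: j2.-1] else [::])]].
  apply/subsetP => y; rewrite !inE => /andP[yK sK].
  have yI := subsetP (components_sub KI) _ yK.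
  have {sK} : succ y \notin intervals i1 i2 j1 j2.
    by apply: contra sK => sI; exact: components_adj KI yK sI (succ_adj y).
  move: yI; rewrite !inE (lab_atK lab) => yI.
  have ln := lab_lt lab y.
  have ij : (pos y).+1 < n -> (pos y).+1 %% n = (pos y).+1 by exact: modn_small.
  move=> sI; have [e|[e jj]] : pos y = i2.-1 \/ pos y = j2.-1 /\ j1 < j2.
  - case: (ltnP (pos y).+1 n) => h; first by rewrite ij // in sI; lia.
    by have -> : pos y = n.-1; lia.
  - by rewrite -e (lab_posK lab) eqxx.
  - by rewrite jj /= inE -e (lab_posK lab) eqxx orbT.
rewrite /arcs; apply: leq_trans (subset_leq_card sub) _.
rewrite cardsE; apply: leq_trans (card_size _) _.
by rewrite size_map /=; case: (ltnP j1 j2).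
Qed.

(* The edges joining two disjoint arcs are nested like the rungs of a ladder.
   [a b] and [a' b'] are the two consecutive rungs around the middle; if one of
   them is missing, a virtual rung just outside the arcs replaces it. *)
Lemma ladder_rungs i1 i2 j1 j2 : 0 < i1 <= i2 -> i2 <= j1 <= j2 -> j2 <= n ->
  let rung a b := [&& i1 <= a < i2, j1 <= b < j2 & adj (at_ a) (at_ b)] in
  let w := (i2 - i1) + (j2 - j1) in
  exists a b a' b', [/\
    rung a b \/ a = i1.-1 /\ b = j2,
    rung a' b' \/ a' = i2 /\ b' = j1.-1,
    forall c d, rung c d -> c <= a /\ b <= d \/ a' <= c /\ d <= b',
    2 * ((a - i1) + (j2 - b.+1)) <= w /\ 2 * ((i2 - a'.+1) + (b' - j1)) <= w
    & a <= a' /\ b' <= b].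
Proof.
move=> hi hj jn rung w.
(* The number of vertices of the two arcs strictly outside the rung. *)
pose out c d := (c - i1) + (j2.-1 - d).
have nest c d c' d' : rung c d -> rung c' d' -> c < c' -> d' <= d.
  move=> /and3P[hc hd cd] /and3P[hc' hd' cd'] cc'; rewrite leqNgt;
    apply/negP => dd.
  by apply: (@noncross c c' d d') => //; lia.
pose up (p : 'I_n * 'I_n) := rung p.1 p.2 && (2 * out p.1 p.2 <= w).
pose dn (p : 'I_n * 'I_n) := rung p.1 p.2 && (w < 2 * out p.1 p.2).
have ordn c d : rung c d -> exists p : 'I_n * 'I_n, p.1 = c :> nat /\
  p.2 = d :> nat.
  move=> /and3P[hc hd _]; have cn : c < n by lia.
  have dn' : d < n by lia.
  by exists (Ordinal cn, Ordinal dn').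
(* The innermost rung with at most half of the vertices outside it; the next one is the outermost
   rung with more than half outside, hence less than half inside. *)
have [a [b [hab ho hup]]] : exists a b, [/\ rung a b \/ a = i1.-1 /\ b = j2,
     2 * ((a - i1) + (j2 - b.+1)) <= w &
     forall c d, rung c d -> 2 * out c d <= w -> c <= a /\ b <= d].
  case: (pickP up) => [p0 hp0|none].
    have [[a b] /andP[/= rab hab] hmax] := arg_maxnP (fun p : 'I_n * 'I_n => out
      p.1 p.2) hp0.
    exists a, b; split; [by left|rewrite /out in hab; lia|].
    move=> c d rcd h; have [p [pc pd]] := ordn _ _ rcd.
    have := hmax p; rewrite /up pc pd rcd h => /(_ isT) /= le.
    have := nest c d a b rcd rab; have := nest a b c d rab rcd.
    move: rab rcd le => /and3P[ra rb _] /and3P[rc rd _]; rewrite /out; lia.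
  exists i1.-1, j2; split; [by right|lia|] => c d rcd h.
  have [p [pc pd]] := ordn _ _ rcd.
  by have := none p; rewrite /up pc pd rcd h.
have [a' [b' [hab' ho' hdn]]] : exists a b, [/\ rung a b /\
  w < 2 * out a b \/ a = i2 /\ b = j1.-1,
     2 * ((i2 - a.+1) + (b - j1)) <= w &
     forall c d, rung c d -> w < 2 * out c d -> a <= c /\ d <= b].
  case: (pickP dn) => [p0 hp0|none].
    have [[a' b'] /andP[/= rab hab'] hmin] := arg_minnP (fun p : 'I_n * 'I_n =>
      out p.1 p.2) hp0.
    exists a', b'; split; [by left| |].
      by move: rab => /and3P[ra rb _]; rewrite /out in hab'; lia.
    move=> c d rcd h; have [p [pc pd]] := ordn _ _ rcd.
    have := hmin p; rewrite /dn pc pd rcd h => /(_ isT) /= le.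
    have := nest c d a' b' rcd rab; have := nest a' b' c d rab rcd.
    move: rab rcd le => /and3P[ra rb _] /and3P[rc rd _]; rewrite /out; lia.
  exists i2, j1.-1; split; [by right|lia|] => c d rcd h.
  have [p [pc pd]] := ordn _ _ rcd.
  by have := none p; rewrite /dn pc pd rcd h.
exists a, b, a', b'; split=> //.
- by case: hab' => [[h _]|h]; [left|right].
- move=> c d rcd; case: (leqP (2 * out c d) w) => h; [left; exact: hup|right;
  exact: hdn].
- case: hab => [rab|]; case: hab' => [[rab' lt]|].
  + have := nest a b a' b' rab rab'; have := nest a' b' a b rab' rab.
    move: rab rab' lt => /and3P[ra rb _] /and3P[rc rd _]; rewrite /out; lia.
  + by move: rab => /and3P[]; lia.
  + by move: rab' => /and3P[]; lia.
  + by lia.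
Qed.

(** Deleting the ends of the two middle rungs leaves four regions. The outer and the inner one have
    at most half of the vertices. The two between the rungs may be larger, but no edge joins them,
    so a component there stays within one arc. *)
Lemma ladder i1 i2 j1 j2 : 0 < i1 <= i2 -> i2 <= j1 <= j2 -> j2 <= n ->
  exists2 ts : seq G, size ts <= 4 &
  forall K, K \in components (intervals i1 i2 j1 j2 :\: [set x in ts]) ->
  exists k1 k2 l1 l2,
    [/\ 0 < k1 <= k2, k2 <= l1 <= l2, l2 <= n,
      K \in components (intervals k1 k2 l1 l2) &
     2 * ((k2 - k1) + (l2 - l1)) <= (i2 - i1) + (j2 - j1) \/
     l2 = l1 /\ k2 - k1 <= maxn (i2 - i1) (j2 - j1)].
Proof.
move=> hi hj jn.
have [a [b [a' [b' [hab hab' hr [ho ho'] [aa bb]]]]]] := ladder_rungs hi hj jn.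
pose rung a b := [&& i1 <= a < i2, j1 <= b < j2 & adj (at_ a) (at_ b)].
have {}hab : rung a b \/ a = i1.-1 /\ b = j2 := hab.
have {}hab' : rung a' b' \/ a' = i2 /\ b' = j1.-1 := hab'.
have {}hr c d : rung c d -> c <= a /\ b <= d \/ a' <= c /\ d <= b' := hr c d.
pose ends c d := if rung c d then [:: at_ c; at_ d] else [::].
exists (ends a b ++ ends a' b').
  by rewrite size_cat /ends; do 2 case: ifP.
set ts := ends a b ++ ends a' b'; set X := intervals i1 i2 j1 j2 => K KX.
pose I p := i1 <= p < i2. pose J p := j1 <= p < j2.
have pos_at p : I p || J p -> pos (at_ p) = p.
  by rewrite /I /J => h; apply: (at_small lab); lia.
have XP x : x \in X :\: [set x in ts] ->
    I (pos x) /\ pos x <> a /\ pos x <> a' \/ J (pos x) /\ pos x <> b /\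
      pos x <> b'.
  rewrite !inE mem_cat negb_or => /andP[/andP[h1 h2] /orP[h|h]]; [left|right];
    split=> //; split=> e.
  - move: h1; rewrite /ends; case: ifP => [_|nr].
      by rewrite !inE -e (lab_posK lab) eqxx.
    by case: hab => [|[ea _]]; [rewrite nr|lia].
  - move: h2; rewrite /ends; case: ifP => [_|nr].
      by rewrite !inE -e (lab_posK lab) eqxx.
    by case: hab' => [|[ea _]]; [rewrite nr|lia].
  - move: h1; rewrite /ends; case: ifP => [_|nr].
      by rewrite !inE -e (lab_posK lab) eqxx orbT.
    by case: hab => [|[_ ea]]; [rewrite nr|lia].
  - move: h2; rewrite /ends; case: ifP => [_|nr].
      by rewrite !inE -e (lab_posK lab) eqxx orbT.
    by case: hab' => [|[_ ea]]; [rewrite nr|lia].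
have inX x : I (pos x) && (pos x != a) && (pos x != a') ||
     J (pos x) && (pos x != b) && (pos x != b') -> x \in X :\: [set x in ts].
  move=> h; have xX : x \in X by rewrite inE -/(I _) -/(J _); lia.
  rewrite inE xX andbT inE mem_cat negb_or.
  apply/andP; split; apply/negP; rewrite /ends; case: ifP => // /and3P[hc hd _];
    rewrite !inE => /orP[] /eqP E; move: h; rewrite E !pos_at /I /J; lia.
(* An edge within one arc cannot pass over an end of a chosen rung, as it would cross that rung; an
   edge between the arcs is itself a rung, and [hr] locates it. *)
have key u v : u \in X :\: [set x in ts] -> v \in X :\: [set x in ts] ->
    adj u v -> pos u < pos v ->
  [\/ [/\ I (pos u), I (pos v), (pos u < a) = (pos v < a) & (pos u < a') = (pos v
    < a')],
      [/\ J (pos u), J (pos v), (pos u < b) = (pos v < b) & (pos u < b') = (pos v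
        < b')],
      [/\ I (pos u), J (pos v), pos u <= a & b <= pos v] |
      [/\ I (pos u), J (pos v), a' <= pos u & pos v <= b']].
  move=> /XP hu /XP hv; rewrite -{1}(lab_posK lab u) -{1}(lab_posK lab v).
  move: (pos u) (pos v) hu hv => p q hu hv pq lt.
  have cr c d c' d' : c < c' -> c' < d -> d < d' -> d' < n ->
      adj (at_ c) (at_ d) -> adj (at_ c') (at_ d') ->
        False := @noncross c c' d d'.
  unfold I, J in *; case: hu hv => [[Ip [pa pa']]|[Jp [pb pb']]] [[Iq [qa
    qa']]|[Jq [qb qb']]].
  - apply: Or41; split=> //; apply/idP/idP => h; try lia.
      rewrite ltnNge; apply/negP => h'. case: hab => [/and3P[ra rb ab]|];
        last lia.
      by apply: (cr p q a b) => //; lia.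
    rewrite ltnNge; apply/negP => h'; case: hab' => [/and3P[ra rb ab]|]; last lia.
    by apply: (cr p q a' b') => //; lia.
  - have /hr : rung p q by rewrite /rung pq Ip Jq.
    by case=> -[h1 h2]; [apply: Or43|apply: Or44].
  - by exfalso; clear -Jp Iq lt hj; lia.
  - apply: Or42; split=> //; apply/idP/idP => h; try lia.
      rewrite ltnNge; apply/negP => h'; case: hab => [/and3P[ra rb ab]|];
        last lia.
      by apply: (cr a b p q) => //; lia.
    rewrite ltnNge; apply/negP => h'; case: hab' => [/and3P[ra rb ab]|]; last lia.
    by apply: (cr a' b' p q) => //; lia.
have [y yK] := components_ex KX; have yX := subsetP (components_sub KX) _ yK.
have fin k1 k2 l1 l2 : y \in intervals k1 k2 l1 l2 ->
   (forall x, x \in intervals k1 k2 l1 l2 -> x \in X :\: [set x in ts]) ->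
   (forall u v, u \in X :\: [set x in ts] -> v \in X :\: [set x in ts] ->
      adj u v -> pos u < pos v ->
      (u \in intervals k1 k2 l1 l2) = (v \in intervals k1 k2 l1 l2)) ->
   K \in components (intervals k1 k2 l1 l2).
  move=> yY YX st; apply: (components_restrict KX); last exact/subsetP.
  apply: (components_in_closed KX yK yY) => u v uX vX uv uY.
  case: (ltngtP (pos u) (pos v)) => h.
  - by rewrite -(st u v).
  - by rewrite (st v u) // adj_sym.
  - by rewrite -(pos_inj h).
have [ia jb] : i1 <= a.+1 <= i2 /\ j1 <= b <= j2.
  by case: hab => [/and3P[h h' _]|]; lia.
have [ia' jb'] : i1 <= a' <= i2 /\ j1 <= b'.+1 <= j2.
  by case: hab' => [/and3P[h h' _]|]; lia.
have /XP hy := yX.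
(* The four regions; those contained in one arc receive an empty second interval. *)
have st k1 k2 l1 l2 : (k1, k2, l1, l2) \in
     [:: (i1, a, b.+1, j2); (a.+1, a', a', a'); (b'.+1, b, b, b); (a'.+1, i2, j1,
       b')] ->
   (forall x, x \in intervals k1 k2 l1 l2 -> x \in X :\: [set x in ts]) /\
   (forall u v, u \in X :\: [set x in ts] -> v \in X :\: [set x in ts] ->
      adj u v -> pos u < pos v ->
      (u \in intervals k1 k2 l1 l2) = (v \in intervals k1 k2 l1 l2)).
  move=> hk; split=> [x|u v uX vX uv lt].
    rewrite inE => hx; apply: inX; rewrite /I /J; move: (pos x) hx => p.
    clear -hk ia jb ia' jb' aa bb hi hj.
    by move: hk; rewrite !inE !xpair_eqE => /or4P[] /andP[/andP[/andP[/eqP->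
      /eqP->] /eqP->] /eqP->]; lia.
  have := key u v uX vX uv lt; have := XP u uX; have := XP v vX;
    rewrite !inE /I /J.
  move: (pos u) (pos v) => p q; clear -hk ia jb ia' jb' aa bb hi hj.
  move=> hq hp [] [h1 h2 h3 h4]; move: hk; rewrite !inE !xpair_eqE;
    move=> /or4P[] /andP[/andP[/andP[/eqP-> /eqP->] /eqP->] /eqP->]; lia.
have hab2 : i1 <= a /\ b < j2 \/ a = i1.-1 /\ b = j2.
  by case: hab => [/and3P[h h' _]|]; [left; clear -h h'; lia|right].
have hab2' : a' < i2 /\ j1 <= b' \/ a' = i2 /\ b' = j1.-1.
  by case: hab' => [/and3P[h h' _]|]; [left; clear -h h'; lia|right].
have in_region k1 k2 l1 l2 : y \in intervals k1 k2 l1 l2 -> (k1, k2, l1, l2) \in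
     [:: (i1, a, b.+1, j2); (a.+1, a', a', a'); (b'.+1, b, b, b); (a'.+1, i2, j1,
       b')] ->
    K \in components (intervals k1 k2 l1 l2).
  by move=> yY /st[h1 h2]; apply: fin yY h1 h2.
have : y \in intervals i1 a b.+1 j2 \/ y \in intervals a.+1 a' a' a' \/
    y \in intervals b'.+1 b b b \/ y \in intervals a'.+1 i2 j1 b'.
  by move: hy; clear; rewrite !inE /I /J; lia.
clear -in_region ia jb ia' jb' aa bb hi hj jn ho ho' hab2 hab2'.
case=> [yY|[yY|[yY|yY]]].
- have h := in_region _ _ _ _ yY; exists i1, a, b.+1, j2.
  split; [| | |by apply: h; rewrite !inE eqxx ?orbT|left]; clear h in_region;
    move: yY; rewrite inE; lia.
- have h := in_region _ _ _ _ yY; exists a.+1, a', a', a'.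
  split; [| | |by apply: h; rewrite !inE eqxx ?orbT|right]; clear h in_region;
    move: yY; rewrite inE; lia.
- have h := in_region _ _ _ _ yY; exists b'.+1, b, b, b.
  split; [| | |by apply: h; rewrite !inE eqxx ?orbT|right]; clear h in_region;
    move: yY; rewrite inE; lia.
- have h := in_region _ _ _ _ yY; exists a'.+1, i2, j1, b'.
  split; [| | |by apply: h; rewrite !inE eqxx ?orbT|left]; clear h in_region;
    move: yY; rewrite inE; lia.
Qed.

End Bound.

(** * The cost of repeated halving *)

Section Bound.
Variables (G : graph) (n : nat) (at_ : nat -> G) (pos : G -> nat).
Hypothesis lab : cycle_labelling n at_ pos.
Hypothesis noncross : forall a b c d, a < b -> b < c -> c < d -> d < n ->
  adj (at_ a) (at_ c) -> adj (at_ b) (at_ d) -> False.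
Implicit Types (A B K T Y : {set G}) (x y u v : G).
Local Notation intervals := (intervals pos).
Local Notation arcs := (arcs at_ pos).

(** Without its midpoint [t], the interval becomes two arcs of at most half its length, so that both
    alternatives of [ladder] lead to components of at most half the size. *)
Lemma elim_interval k w : (forall i1 i2 j1 j2 K,
  K \in components (intervals i1 i2 j1 j2) ->
    0 < i1 <= i2 -> i2 <= j1 <= j2 -> j2 <= n -> (i2 - i1) + (j2 - j1) <= w./2 ->
    elim K k) ->
  forall i1 i2 j K, K \in components (intervals i1 i2 j j) ->
    0 < i1 <= i2 -> i2 <= n -> i2 - i1 <= w -> elim K (10 + k).
Proof.
move=> IH i1 i2 j K KI hi i2n iw.
have {}KI : K \in components (intervals i1 i2 i2 i2).
  by move: KI; congr (_ \in components _); apply/setP => z; rewrite !inE; lia.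
have n0 : at_ 0 \notin K.
  apply/negP => /(subsetP (components_sub KI)).
  rewrite inE (lab_atK lab) mod0n; lia.
have [x xK] := components_ex KI.
have i12 : i1 < i2 by have := subsetP (components_sub KI) _ xK; rewrite inE; lia.
pose t := i1 + (i2 - i1)./2.
have [||//|ts szts hts] := ladder lab noncross (i1 := i1) (i2 := t) (j1 := t.+1)
  (j2 := i2).
- by rewrite /t; lia.
- by rewrite /t; lia.
have ar : arcs K <= 1 by have := arcs_intervals lab i2n i2n KI; rewrite leqnn.
apply: (@elim_le _ _ (k + arcs K + 2 * size (at_ t :: ts) - 1)); last first.
  by rewrite /=; lia.
apply: (elim_phase lab) => // [|K' K'K];
  first exact: components_restrict KI _ (components_sub KI).
have /hts : K' \in components (intervals i1 t t.+1 i2 :\: [set x in ts]).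
  have -> : intervals i1 t t.+1 i2 :\: [set x in ts] =
            intervals i1 i2 i2 i2 :\: [set x in at_ t :: ts].
    apply/setP => z; rewrite !inE negb_or -andbA andbCA; congr (_ && _).
    have -> : (z == at_ t) = (pos z == t).
      apply/eqP/eqP => [->|<-]; last by rewrite (lab_posK lab).
      by rewrite (at_small lab) // /t; lia.
    by rewrite /t; lia.
  exact: components_setD K'K.
move=> [k1 [k2 [l1 [l2 [hk hl hn K'I]]]]] hw; apply: IH K'I hk hl hn _.
by move: hw; rewrite /t; lia.
Qed.

(* Halving costs [2 + 2 * 4 - 1 = 9] on two arcs, by the ladder lemma, after which
   a component inside one arc may still be too large; the latter costs
   [1 + 2 * 5 - 1 = 10] more, by deleting also its midpoint. *)
Lemma elim_bound w i1 i2 j1 j2 K : K \in components (intervals i1 i2 j1 j2) ->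
  0 < i1 <= i2 -> i2 <= j1 <= j2 -> j2 <= n -> (i2 - i1) + (j2 - j1) <= w ->
  elim K (19 * trunc_log 2 w).
Proof.
elim/ltn_ind: w i1 i2 j1 j2 K => w IH i1 i2 j1 j2 K KI hi hj jn hw.
have [x xK] := components_ex KI.
have w0 : 0 < w by have := subsetP (components_sub KI) _ xK; rewrite inE; lia.
have [w1|w1] := leqP w 1.
  apply: elim_card1; apply/eqP/cards1P; exists x.
  apply/setP => y; rewrite inE; apply/idP/eqP => [yK|->//].
  have := subsetP (components_sub KI) _ xK;
    have := subsetP (components_sub KI) _ yK.
  by rewrite !inE => hy hx; apply: (pos_inj lab); lia.
have n0 : at_ 0 \notin K.
  apply/negP => /(subsetP (components_sub KI)).
  rewrite inE (lab_atK lab) mod0n; lia.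
have IHh i1' i2' j1' j2' K' : K' \in components (intervals i1' i2' j1' j2') ->
    0 < i1' <= i2' -> i2' <= j1' <= j2' -> j2' <= n ->
    (i2' - i1') + (j2' - j1') <= w./2 -> elim K' (19 * trunc_log 2 w./2).
  by move=> *; apply: IH; eauto; lia.
rewrite trunc_log2S //.
have [ts szts hts] := ladder lab noncross hi hj jn.
have ar : arcs K <= 2.
  by apply: leq_trans (arcs_intervals lab _ jn KI) _; [lia|rewrite leq_subr].
apply: (@elim_le _ _ (10 + 19 * trunc_log 2 w./2 + arcs K + 2 * size ts - 1));
  last by lia.
apply: (elim_phase lab) => // [|K' K'K];
  first exact: components_restrict KI _ (components_sub KI).
have /hts[k1 [k2 [l1 [l2 [hk hl ln K'I]]]]] := components_setD KI K'K.
case=> [hw'|[ll hw']].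
  by apply: (@elim_le _ _ (19 * trunc_log 2 w./2)); [apply: IHh K'I hk hl ln _|];
    lia.
rewrite ll in K'I; apply: (elim_interval IHh K'I hk); lia.
Qed.

(** Deleting [at_ 0] opens the cycle into one path, at cost 1; from then on no interval wraps
    around. *)
Lemma elim_total : 0 < n -> elim [set: G] (1 + 19 * trunc_log 2 n.-1).
Proof.
move=> n_gt0.
have a0 : at_ 0 \notin [set: G] :\ at_ 0 by rewrite !inE eqxx.
apply: (@Elim _ _ (at_ 0) (19 * trunc_log 2 n.-1)); first by rewrite inE.
  move=> K; have -> : [set: G] :\ at_ 0 = intervals 1 n n n.
    apply/setP => y; rewrite !inE andbT.
    have -> : (y == at_ 0) = (pos y == 0).
      apply/eqP/eqP => [->|<-]; last by rewrite (lab_posK lab).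
      by rewrite (lab_atK lab) mod0n.
    by have := lab_lt lab y; lia.
  by move=> KI; apply: elim_bound KI _ _ _ _; lia.
rewrite leq_add2r; apply: leq_trans (card_components_le lab a0) _.
apply: leq_trans (arcs_setD1 lab _ _) _; rewrite ltnS leqn0 cards_eq0.
by apply/eqP/setP => y; rewrite !inE.
Qed.
End Bound.

(** * Defining formulas *)

(* Quantifier words of the form forall^* exists^*. *)
Fixpoint ae_word (s : seq bool) :=
  if s is b :: s' then if b then all id s' else ae_word s' else true.

(* Quantifier words of the form exists^* forall^* exists^*. *)
Fixpoint eae_word (s : seq bool) :=
  if s is b :: s' then if b then eae_word s' else ae_word s' else true.

Lemma ae_of_e s : all id s -> ae_word s.
Proof. by case: s => //= -[]. Qed.

Lemma eae_of_ae s : ae_word s -> eae_word s.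
Proof.
elim: s => //= -[] s IH // h.
by apply/IH/ae_of_e.
Qed.

Lemma alternations_cons a b s :
  alternations (a :: b :: s) = (a != b) + alternations (b :: s).
Proof. by []. Qed.

Lemma alternations_e s : all id s -> alternations s = 0.
Proof. by elim: s => //= -[] [|[] s] IH //= h; rewrite IH. Qed.

Lemma alternations_ae s : ae_word s -> alternations s <= 1.
Proof.
elim: s => // -[] s IH h; first by rewrite (@alternations_e (true :: s)).
case: s h IH => [|[] s] // h IH; rewrite alternations_cons; last exact: IH.
by rewrite (@alternations_e (true :: s)).
Qed.

Lemma alternations_eae s : eae_word s -> alternations s <= 2.
Proof.
elim: s => // -[] s IH h; last by apply: leqW;
  exact: (@alternations_ae (false :: s)).
case: s h IH => [|[] s] // h IH; rewrite alternations_cons; first exact: IH.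
by rewrite add1n ltnS; exact: (@alternations_ae (false :: s)).
Qed.

(** * Properties expressible with given rank and quantifier words *)

Section Expressible.
Implicit Types (W : pred (seq bool)) (H : graph).

(** Formulas are handled through the properties of pebbled graphs that they express, so that only
    rank and quantifier words have to be tracked. *)
Definition query k := forall H, ('I_k -> H) -> Prop.

Definition expressible W r k (Q : query k) :=
  exists p : formula k,
    [/\ qrank p <= r, all W (nest p) & forall H (e : 'I_k -> H), sat p e <->
      Q H e].

Lemma expressible_ext W r k (Q Q' : query k) :
  (forall H (e : 'I_k -> H), Q H e <-> Q' H e) ->
  expressible W r Q -> expressible W r Q'.
Proof. by move=> E [p [h1 h2 h3]]; exists p; split=> // H e; rewrite h3. Qed.

Lemma expressible_le W W' r r' k (Q : query k) : subpred W W' -> r <= r' ->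
  expressible W r Q -> expressible W' r' Q.
Proof.
move=> WW rr [p [h1 h2 h3]]; exists p; split=> //; first exact: leq_trans rr.
exact: sub_all WW _ h2.
Qed.

Lemma expressible_eq W r k (i j : 'I_k) : W [::] ->
  expressible W r (fun H e => e i = e j).
Proof.
by move=> w; exists (FEq i j); split=> //= [|H e]; [rewrite w|split=> /eqP].
Qed.

Lemma expressible_neq W r k (i j : 'I_k) : W [::] ->
  expressible W r (fun H e => e i <> e j).
Proof.
by move=> w; exists (FNot (FEq i j)); split=> //= [|H e];
  [rewrite w|split=> /eqP].
Qed.

Lemma expressible_adj W r k (i j : 'I_k) b : W [::] ->
  expressible W r (fun H e => adj (e i) (e j) = b).
Proof.
case: b => w.
  by exists (FAdj i j); split=> //=; rewrite w.
exists (FNot (FAdj i j)); split=> //= [|H e]; first by rewrite w.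
by split=> [/negbTE|->].
Qed.

Lemma expressible_and W r k (Q Q' : query k) :
  expressible W r Q -> expressible W r Q' ->
  expressible W r (fun H e => Q H e /\ Q' H e).
Proof.
move=> [p [h1 h2 h3]] [p' [h1' h2' h3']]; exists (FAnd p p'); split=> /=.
- by rewrite geq_max h1.
- by rewrite all_cat h2.
- move=> H e; split=> [/andP[/h3 ? /h3' ?] //|[/h3 -> /h3' ->] //].
Qed.

Lemma expressible_or W r k (Q Q' : query k) :
  expressible W r Q -> expressible W r Q' ->
  expressible W r (fun H e => Q H e \/ Q' H e).
Proof.
move=> [p [h1 h2 h3]] [p' [h1' h2' h3']]; exists (FOr p p'); split=> /=.
- by rewrite geq_max h1.
- by rewrite all_cat h2.
- move=> H e; split=> [/orP[/h3|/h3']|[/h3 ->|/h3' ->]] //; try by [left|right].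
  by rewrite orbT.
Qed.

(** The variable ['I_k] is there to write the empty conjunction as an equality. *)
Lemma expressible_forall_in W r k (I : eqType) (l : seq I) (Q : I -> query k) :
  'I_k -> W [::] -> (forall i, expressible W r (Q i)) ->
  expressible W r (fun H e => forall i, i \in l -> Q i H e).
Proof.
move=> j w h; elim: l => [|i l IH].
  by apply: expressible_ext (expressible_eq r j j w) => H e; split.
apply: expressible_ext (expressible_and (h i) IH) => H e; split.
  by move=> [hi hl] i'; rewrite inE => /orP[/eqP->|/hl].
by move=> hl; split=> [|i' i'l]; apply: hl; rewrite inE ?eqxx ?i'l ?orbT.
Qed.

Lemma expressible_exists_in W r k (I : eqType) (l : seq I) (Q : I -> query k) :
  'I_k -> W [::] -> (forall i, expressible W r (Q i)) ->
  expressible W r (fun H e => exists2 i, i \in l & Q i H e).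
Proof.
move=> j w h; elim: l => [|i l IH].
  by apply: expressible_ext (expressible_neq r j j w) => H e; split=> // -[].
apply: expressible_ext (expressible_or (h i) IH) => H e; split.
  by move=> [hi|[i' i'l hi]]; [exists i|exists i'] => //;
    rewrite inE ?eqxx ?i'l ?orbT.
by move=> [i']; rewrite inE => /orP[/eqP->|i'l]; [left|right; exists i'].
Qed.

Lemma expressible_forall r k (Q : query k.+1) :
  expressible ae_word r Q ->
  expressible ae_word r.+1 (fun H (e : 'I_k -> H) => forall x, Q H (scons x e)).
Proof.
move=> [p [h1 h2 h3]]; exists (FAll p); split=> //=; first by rewrite all_map.
move=> H e; split=> [/forallP h x|h]; first exact/h3.
by apply/forallP => x; apply/h3.
Qed.

Lemma expressible_exists W r k (Q : query k.+1) :
  (forall s, W s -> W (true :: s)) -> expressible W r Q ->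
  expressible W r.+1 (fun H (e : 'I_k -> H) => exists x, Q H (scons x e)).
Proof.
move=> w [p [h1 h2 h3]]; exists (FEx p); split=> //=.
  by rewrite all_map; apply: sub_all h2.
move=> H e; split=> [/existsP[x /h3 h]|[x /h3 h]]; first by exists x.
by apply/existsP; exists x.
Qed.

Lemma scons0 k (T : Type) (x : T) (e : 'I_k -> T) : scons x e ord0 = x.
Proof. by rewrite /scons unlift_none. Qed.

Lemma scons_lift k (T : Type) (x : T) (e : 'I_k -> T) i :
  scons x e (lift ord0 i) = e i.
Proof. by rewrite /scons liftK. Qed.

Definition catenv m k (T : Type) (xs : 'I_m -> T) (e : 'I_k -> T) : 'I_(m + k) ->
  T :=
  fun i => match fintype.split i with inl l => xs l | inr j => e j end.

Lemma catenv_l m k (T : Type) (xs : 'I_m -> T) (e : 'I_k -> T) l :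
  catenv xs e (lshift k l) = xs l.
Proof. by rewrite /catenv (unsplitK (inl _ l)). Qed.

Lemma catenv_r m k (T : Type) (xs : 'I_m -> T) (e : 'I_k -> T) j :
  catenv xs e (rshift m j) = e j.
Proof. by rewrite /catenv (unsplitK (inr _ j)). Qed.

Lemma catenv_scons m k (T : Type) x (xs : 'I_m -> T) (e : 'I_k -> T) :
  catenv (scons x xs) e = scons x (catenv xs e).
Proof.
apply/funext => i; case: (@split_ordP m.+1 k i) => j ->.
  rewrite catenv_l; case: (unliftP ord0 j) => [l|] ->.
    have -> : lshift k (lift ord0 l) = lift ord0 (lshift k l) by exact/val_inj.
    by rewrite !scons_lift catenv_l.
  have -> : lshift k ord0 = ord0 :> 'I_(m.+1 + k) by exact/val_inj.
  by rewrite !scons0.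
rewrite catenv_r.
have -> : rshift m.+1 j = lift ord0 (rshift m j) by exact/val_inj.
by rewrite (@scons_lift (m + k)) catenv_r.
Qed.

Lemma expressible_existsn W r m k (Q : query (m + k)) :
  (forall s, W s -> W (true :: s)) -> expressible W r Q ->
  expressible W (m + r)
    (fun H (e : 'I_k -> H) => exists xs : 'I_m -> H, Q H (catenv xs e)).
Proof.
move=> w; elim: m r Q => [|m IH] r Q hQ.
  apply: expressible_ext hQ => H e.
  have E xs : catenv xs e = e :> ('I_(0 + k) -> H).
    by apply/funext => i; rewrite -(@catenv_r 0 _ _ xs e); congr catenv;
      apply/val_inj.
  split=> [h|[xs]]; last by rewrite E.
  by exists (@env0 H); rewrite E.
rewrite addSnnS; have := IH _ _ (expressible_exists w hQ).
apply: expressible_ext => H e; split=> [[xs [x h]]|[xs h]].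
  by exists (scons x xs); rewrite catenv_scons.
exists (fun i => xs (lift ord0 i)), (xs ord0); rewrite -catenv_scons.
congr (Q _ (catenv _ _)): h; apply/funext => i.
by case: (unliftP ord0 i) => [j|] ->; rewrite ?scons_lift ?scons0.
Qed.

End Expressible.

(* [u] and [v] are joined by a walk of length at most [2 ^ L] outside [avoid]. *)
Fixpoint near (H : graph) (avoid : seq H) L (u v : H) : Prop :=
  if L is L'.+1 then exists z, near avoid L' u z /\ near avoid L' z v
  else v \notin avoid /\ (u = v \/ adj u v = true).

Lemma near_inv (H : graph) (avoid : seq H) (P : H -> Prop) L u v :
  (forall x y, P x -> adj x y -> y \notin avoid -> P y) ->
  near avoid L u v -> P u -> P v.
Proof.
move=> h; elim: L u v => [|L IH] u v /=.
  by move=> [va [<-//|uv]] Pu; exact: h uv va.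
by move=> [z [/IH uz /IH zv]] /uz /zv.
Qed.

Lemma path_near (H : graph) (avoid : seq H) L u s : path (@adj H) u s ->
  size s <= 2 ^ L -> all (fun x => x \notin avoid) (u :: s) ->
  near avoid L u (last u s).
Proof.
elim: L u s => [|L IH] u s.
  case: s => [|v [|w s]] //=; first by move=> _ _ /andP[ua _]; split=> //; left.
  by rewrite !andbT => uv _ /andP[_ va]; split=> //; right.
move=> + sz; rewrite -{1 2 3}(cat_take_drop (2 ^ L) s).
set s1 := take _ s; set s2 := drop _ s.
rewrite cat_path last_cat -cat_cons all_cat => /andP[p1 p2] /andP[a1 a2].
exists (last u s1); split; apply: IH => //.
- by rewrite size_take; case: ltnP.
- by move: sz; rewrite size_drop expnS; lia.
- by rewrite /= a2 andbT; apply: (allP a1); exact: mem_last.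
Qed.

(** Both halves of the walk stand under the same quantifier for the midpoint: doubling the length
    raises the rank by one. *)
Lemma expressible_near L k (A : seq 'I_k) (i j : 'I_k) :
  expressible (all id) L
    (fun H (e : 'I_k -> H) => near [seq e a | a <- A] L (e i) (e j)).
Proof.
elim: L k A i j => [|L IH] k A i j.
  have h1 : expressible (all id) 0
      (fun H (e : 'I_k -> H) => forall a, a \in A -> e j <> e a).
    by apply: expressible_forall_in => // a; exact: expressible_neq.
  apply: expressible_ext (expressible_and h1 (expressible_or
    (@expressible_eq (all id) 0 k i j isT) (@expressible_adj (all id) 0 k i j
      true isT))).
  move=> H e /=; split=> -[h h']; split=> //.
    by apply/mapP => -[a aA /(h a aA)].
  by move=> a aA E; move/negP: h; apply; rewrite E map_f.
have := expressible_and (IH k.+1 [seq lift ord0 a | a <- A] (lift ord0 i) ord0)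
                        (IH k.+1 [seq lift ord0 a | a <- A] ord0 (lift ord0 j)).
move=> /(@expressible_exists (all id) _ _ _ (fun s h => h));
  apply: expressible_ext => H e /=.
have E x : [seq scons x e a | a <- [seq lift ord0 a | a <- A]] = [seq e a | a <-
  A].
  by rewrite -map_comp; apply: eq_map => a /=; rewrite scons_lift.
by split=> -[x h]; exists x; move: h; rewrite !scons_lift !scons0 !E.
Qed.

(** * Describing components relative to the pebbles *)

Section Main.
Variables (G : graph) (L : nat).
Hypothesis G_le : #|G| <= 2 ^ L.
Implicit Types (K A : {set G}) (x y u v : G).

Lemma components_near A K (avoid : seq G) u v : K \in components A -> u \in K ->
  v \in K ->
  (forall x, x \in avoid -> x \notin A) -> near avoid L u v.
Proof.
move=> KA uK vK hav; have KsA := fintype.subsetP (components_sub KA).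
have : v \in component A u by rewrite -(components_component KA uK).
rewrite inE => /connectP[s p ->]; move: p => /shortenP[s' p' us' _].
have inA : all (mem A) (u :: s').
  rewrite /= KsA //=; elim: s' u {uK us'} p' => //= y s' IH u /andP[/and3P[_ yA
    _] p].
  by rewrite yA /=; exact: IH p.
apply: path_near.
- by apply: sub_path p' => a b /and3P[].
- by apply: leq_trans G_le; apply: ltnW; have := max_card (mem (u :: s'));
  rewrite (card_uniqP us').
- by apply: sub_all inA => x /= xA; apply/negP => /hav; rewrite xA.
Qed.

(* All pebbles count as deleted, so that only the component [K] of the pebble
   [e i] remains to be matched. *)
Definition extends K k (e : 'I_k -> G) (i : 'I_k) (H : graph) (e' : 'I_k -> H) :=
  exists f : G -> H, f (e i) = e' i /\
   [/\ {in K &, injective f}, {in K &, forall u v, adj (f u) (f v) = adj u v},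
      (forall u j, u \in K -> u <> e i -> f u <> e' j),
      (forall u j, u \in K -> adj (f u) (e' j) = adj u (e j)) &
      (forall u z, u \in K -> adj (f u) z ->
         (exists2 v, v \in K & z = f v) \/ exists j, z = e' j)].

Definition same_diagram k (e : 'I_k -> G) (H : graph) (e' : 'I_k -> H) :=
  forall j l, (e j = e l <-> e' j = e' l) /\ adj (e' j) (e' l) = adj (e j) (e l).

Lemma expressible_same_diagram k (e : 'I_k ->
  G) r (W : pred (seq bool)) : 'I_k -> W [::] ->
  expressible W r (fun H (e' : 'I_k -> H) => same_diagram e e').
Proof.
move=> i0 w.
have h1 (p : 'I_k * 'I_k) : expressible W r (fun H (e' : 'I_k -> H) =>
    (e p.1 = e p.2 <-> e' p.1 = e' p.2) /\
    adj (e' p.1) (e' p.2) = adj (e p.1) (e p.2)).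
  apply: expressible_and (expressible_adj _ _ _ _ w).
  case: (eqVneq (e p.1) (e p.2)) => [E|/eqP E].
    by apply: expressible_ext (expressible_eq r p.1 p.2 w) => H e';
      split=> [|[h _]] //; exact: h.
  apply: expressible_ext (expressible_neq r p.1 p.2 w) => H e';
    split=> [h|[_ h] /h //].
  by split.
have := @expressible_forall_in W r k _ (enum {: 'I_k * 'I_k})
  (fun p H (e' : 'I_k -> H) => (e p.1 = e p.2 <-> e' p.1 = e' p.2) /\
    adj (e' p.1) (e' p.2) = adj (e p.1) (e p.2)) i0 w h1.
apply: expressible_ext => H e'; split=> [h j l|h p _]; last exact: h.
by apply: (h (j, l)); rewrite mem_enum.
Qed.

Section Glue.
Variables (K : {set G}) (x : G) (k m : nat) (e : 'I_k -> G) (i : 'I_k).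
Variables (C : 'I_m -> {set G}) (xs : 'I_m -> G).
Hypotheses (ei : e i = x) (eK : forall j, e j \in K -> e j = x).
Hypothesis CK : forall l, C l \in components (K :\ x).
Hypothesis C_inj : injective C.
Hypothesis CP : forall y, y \in K -> y <> x -> exists l, y \in C l.
Hypothesis xsC : forall l, xs l \in C l.

Lemma piece_sub l u : u \in C l -> u \in K /\ u <> x.
Proof.
move=> /(fintype.subsetP (components_sub (CK l))).
by rewrite !inE => /andP[/eqP ux uK].
Qed.

Lemma piece_eq l l' u : u \in C l -> u \in C l' -> l = l'.
Proof.
move=> ul ul'; apply: C_inj.
by rewrite (components_component (CK l) ul) (components_component (CK l') ul').
Qed.

Lemma piece_adj l l' u v : u \in C l -> v \in C l' -> adj u v -> l = l'.
Proof.
move=> ul vl' uv; apply: (piece_eq _ vl'); apply: components_adj (CK l) ul _ uv.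
by rewrite !inE; have [-> /eqP ->] := piece_sub vl'.
Qed.

(** The maps of the pieces are glued, with [x] sent to [e' i]. That different pieces have disjoint,
    nonadjacent images follows from the pebbles and the closure of each image under adjacency. The
    last hypothesis puts the neighbours of [e' i] into these images. *)
Lemma pieces_extend (H : graph) (e' : 'I_k -> H) (ys : 'I_m -> H) :
  same_diagram (catenv xs e) (catenv ys e') ->
  (forall l, extends (C l) (catenv xs e) (lshift k l) (catenv ys e')) ->
  (forall z, adj (e' i) z -> (exists j, z = e' j) \/
     exists l, near [seq e' j | j <- enum 'I_k] L (ys l) z) ->
  extends K e i e'.
Proof.
move=> diag /choice[f hf] close.
have D l l' : xs l = xs l' <-> ys l = ys l'.
  by have [] := diag (lshift k l) (lshift k l'); rewrite !catenv_l.
have Dr l j : xs l = e j <-> ys l = e' j.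
  by have [] := diag (lshift k l) (rshift m j); rewrite !catenv_l !catenv_r.
have De j j' : adj (e' j) (e' j') = adj (e j) (e j').
  by have [_] := diag (rshift m j) (rshift m j'); rewrite !catenv_r.
have fxs l : f l (xs l) = ys l by have [] := hf l; rewrite !catenv_l.
have f_inj l : {in C l &, injective (f l)} by have [_ []] := hf l.
have f_adj l : {in C l &, forall u v, adj (f l u) (f l v) = adj u v}.
  by have [_ []] := hf l.
have f_ys l l' u : u \in C l -> u <> xs l -> f l u <> ys l'.
  by have [_ [_ _ h _ _]] := hf l; have := h u (lshift k l'); rewrite !catenv_l.
have f_adj_ys l l' u : u \in C l -> adj (f l u) (ys l') = adj u (xs l').
  by have [_ [_ _ _ h _]] := hf l; have := h u (lshift k l'); rewrite !catenv_l.
have f_adj_e l j u : u \in C l -> adj (f l u) (e' j) = adj u (e j).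
  by have [_ [_ _ _ h _]] := hf l; have := h u (rshift m j); rewrite !catenv_r.
have xs_e l j : xs l <> e j.
  by have [lK lx] := piece_sub (xsC l) => E; apply: lx; rewrite E eK // -E.
have f_e l j u : u \in C l -> f l u <> e' j.
  move=> uC; case: (pselect (u = xs l)) => [->|ux].
    by rewrite fxs => /Dr/xs_e.
  have [_ [_ _ h _ _]] := hf l; have := h u (rshift m j) uC.
  by rewrite !catenv_r catenv_l; exact.
have step l u z : u \in C l -> adj (f l u) z -> (forall j, z <> e' j) ->
    exists2 v, v \in C l & z = f l v.
  move=> uC uz ze; have [_ [_ _ _ _ h]] := hf l.
  case: (h u z uC uz) => // -[j zj]; case: (@split_ordP m k j) zj => j' ->.
    rewrite catenv_l => zj; exists (xs j'); last first.
      have uj : adj u (xs j') by rewrite -(f_adj_ys l) // -zj.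
      by rewrite -(piece_adj uC (xsC j') uj) in zj *; rewrite fxs.
    have uj : adj u (xs j') by rewrite -(f_adj_ys l) // -zj.
    by rewrite (piece_adj uC (xsC j') uj).
  by rewrite catenv_r => /ze.
(* A common point of two images propagates through the connected piece [C l'], so that [ys l'] lies
   in the image of [C l]. There it can only be [ys l], and the diagram gives [xs l = xs l']. *)
have disj l l' u v : u \in C l -> v \in C l' -> f l u = f l' v -> l = l'.
  move=> uC vC uv.
  have : xs l' \in component (K :\ x) v.
    by rewrite -(components_component (CK l') vC).
  rewrite inE => c.
  have [_ [w wC wE]] : xs l' \in C l' /\ exists2 w,
    w \in C l & f l' (xs l') = f l w.
    apply: (connect_inv (P := fun t => t \in C l' /\ exists2 w,
      w \in C l & f l' t = f l w)) c _.
      move=> s t [sC [w wC sw]] /and3P[_ tA st].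
      have tC := components_adj (CK l') sC tA st; split=> //.
      have wt : adj (f l w) (f l' t) by rewrite -sw f_adj.
      by have [w' w'C w'E] := step _ _ _ wC wt (fun j => @f_e _ j _ tC);
        exists w'.
    by split=> //; exists u.
  case: (pselect (w = xs l)) wE => [->|wx].
    by rewrite !fxs => /D E; apply: piece_eq (xsC l) _; rewrite -E.
  by rewrite fxs => /esym /(f_ys _ _ _ wC wx).
pose g u := if [pick l | u \in C l] is Some l then f l u else e' i.
have gC l u : u \in C l -> g u = f l u.
  rewrite /g => uC; case: pickP => [l' uC'|/(_ l)]; last by rewrite uC.
  by rewrite (piece_eq uC uC').
have gx : g x = e' i.
  by rewrite /g; case: pickP => // l /piece_sub[].
have KP u : u \in K -> u = x \/ exists l, u \in C l.
  by move=> uK; case: (pselect (u = x)); [left|right; exact: CP].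
exists g; rewrite ei; split=> //; split.
- move=> u v /KP[->|[l ul]] /KP[->|[l' vl']] //;
  rewrite ?gx ?(gC _ _ ul) ?(gC _ _ vl').
  + by move/esym/f_e; elim.
  + by move/f_e; elim.
  + by move=> E; have ll := disj _ _ _ _ ul vl' E; subst l'; exact: f_inj E.
- move=> u v /KP[->|[l ul]] /KP[->|[l' vl']];
  rewrite ?gx ?(gC _ _ ul) ?(gC _ _ vl').
  + by rewrite !adj_irrefl.
  + by rewrite adj_sym f_adj_e // ei adj_sym.
  + by rewrite f_adj_e // ei.
  + apply/idP/idP => uv.
      have [w wC wE] := step _ _ _ ul uv (fun j => @f_e _ j _ vl').
      have ll := disj _ _ _ _ vl' wC wE; subst l'.
      by move: uv; rewrite f_adj.
    by have ll := piece_adj ul vl' uv; subst l'; rewrite f_adj.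
- by move=> u j /KP[->//|[l ul]] _; rewrite (gC _ _ ul); exact: f_e.
- move=> u j /KP[->|[l ul]]; rewrite ?gx ?(gC _ _ ul).
    by rewrite De ei.
  exact: f_adj_e.
- move=> u z uK; case: (pselect (exists j, z = e' j)) => [|ze]; first by right.
  have {}ze j : z <> e' j by move=> E; apply: ze; exists j.
  have img l v : v \in C l -> exists2 v', v' \in K & f l v = g v'.
    by move=> vC; exists v; [exact: (piece_sub vC).1|rewrite (gC _ _ vC)].
  case/KP: uK => [->|[l ul]]; rewrite ?gx ?(gC _ _ ul) => uz; left.
    case: (close z uz) => [[j /ze//]|[l hl]].
    have : exists2 v, v \in C l & z = f l v.
      apply: (near_inv (P := fun z => exists2 v, v \in C l & z = f l v)) hl _.
        move=> s t [v vC ->] vt tn; apply: step vC vt _ => j E; move/negP: tn;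
          apply.
        by apply/mapP; exists j; rewrite ?mem_enum.
      by exists (xs l); rewrite ?fxs.
    by move=> [v vC ->]; exact: img.
  by have [v vC ->] := step _ _ _ ul uz ze; exact: img.
Qed.

End Glue.

(** The vertex [x] is chosen before the pebbles, as it depends on the dismantling only. The [m] new
    pebbles are quantified once and shared by the descriptions of all components, so the rank is
    [m + (b + L.+1)], within the budget [c + L.+1]. *)
Lemma elim_query K b : elim K b -> exists2 x, x \in K &
  forall k (e : 'I_k -> G) (i : 'I_k), e i = x ->
  (forall j, e j \in K -> e j = x) ->
  (forall u v, u \in K -> adj u v -> v \in K \/ exists j, v = e j) ->
  exists Q : query k, [/\ expressible eae_word (b + L.+1) Q, Q G e &
    forall (H : graph) (e' : 'I_k -> H), Q H e' -> extends K e i e'].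
Proof.
elim=> {K b} K x b c xK _ IH le; exists x => // k e i ei eK cl.
set m := ncomponents (K :\ x) in le.
pose C (l : 'I_m) : {set G} := enum_val l.
have CK l : C l \in components (K :\ x) by exact: enum_valP.
have C_inj : injective C by exact: enum_val_inj.
have CP y : y \in K -> y <> x -> exists l, y \in C l.
  move=> yK /eqP yx; have yA : y \in K :\ x by rewrite !inE yx.
  have h := components_mem yA; exists (enum_rank_in h (component (K :\ x) y)).
  by rewrite /C enum_rankK_in // component_refl.
(* The pebble in each component is the vertex to be deleted next there. *)
have /choice[xs hxs] : forall l, exists y, y \in C l /\ _ := fun l =>
  let: ex_intro2 y h1 h2 := IH _ (CK l) in ex_intro _ y (conj h1 h2).
have xsC l : xs l \in C l by case: (hxs l).
pose e1 := catenv xs e.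
have old (j : 'I_k) l : e j \notin C l.
  apply/negP => jC; have [jK jx] := piece_sub CK jC; exact: jx (eK _ jK).
have /choice[Q hQ] : forall l, exists Q : query (m + k),
   [/\ expressible eae_word (b + L.+1) Q, Q G e1 &
    forall (H : graph) (e' : 'I_(m + k) -> H), Q H e' ->
      extends (C l) e1 (lshift k l) e'].
  move=> l; have [_ h] := hxs l; apply: h; first exact: catenv_l.
    move=> j; case: (@split_ordP m k j) => j' ->; rewrite /e1 ?catenv_l ?catenv_r.
      by move=> jC; rewrite (piece_eq CK C_inj jC (xsC j')).
    by rewrite (negbTE (old _ _)).
  move=> u v uC uv; have [uK ux] := piece_sub CK uC.
  case: (cl u v uK uv) => [vK|[j ->]]; last first.
    by right; exists (rshift m j); rewrite /e1 catenv_r.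
  case: (pselect (v = x)) => [->|/eqP vx].
    by right; exists (rshift m i); rewrite /e1 catenv_r.
  by left; apply: components_adj (CK l) uC _ uv; rewrite !inE vx.
pose close (H : graph) (e' : 'I_(m + k) -> H) := forall z,
  adj (e' (rshift m i)) z = false \/
  ((exists2 j, j \in enum 'I_k & z = e' (rshift m j)) \/
   exists2 l, l \in enum 'I_m &
     near [seq e' j | j <- [seq rshift m j | j <- enum 'I_k]] L (e' (lshift k l))
       z).
have close_expr : expressible eae_word (b + L.+1) close.
  apply: (@expressible_le ae_word _ L.+1) => //;
    [exact: eae_of_ae|exact: leq_addl|].
  have h1 : expressible ae_word L (fun H (e' : 'I_(m + k).+1 -> H) =>
      adj (e' (lift ord0 (rshift m i))) (e' ord0) = false) by exact:
        expressible_adj.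
  have h2 : expressible ae_word L (fun H (e' : 'I_(m + k).+1 -> H) =>
      exists2 j, j \in enum 'I_k & e' ord0 = e' (lift ord0 (rshift m j))).
    apply: expressible_exists_in => [||j]; [exact: ord0|by []|].
    exact: expressible_eq.
  have h3 : expressible ae_word L (fun H (e' : 'I_(m + k).+1 -> H) =>
      exists2 l, l \in enum 'I_m &
      near [seq e' j | j <- [seq lift ord0 (rshift m j) | j <- enum 'I_k]] L
        (e' (lift ord0 (lshift k l))) (e' ord0)).
    apply: expressible_exists_in => [||l]; [exact: ord0|by []|].
    apply: expressible_le (expressible_near _ _ _ _) => //; exact: ae_of_e.
  have := expressible_forall (expressible_or h1 (expressible_or h2 h3)).
  apply: expressible_ext => H e'; split=> h z; move: (h z);
    rewrite scons_lift scons0 => -[h4|[[j j1 j2]|[l l1 l2]]]; try (by left);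
    right; [left; exists j => //|right; exists l => //
      |left; exists j => //|right; exists l => //]; move: j2 || move: l2;
    rewrite ?scons0 ?scons_lift //; congr (near _ _ _ _); rewrite -!map_comp;
    by apply: eq_map => j /=; rewrite scons_lift.
pose Q1 (H : graph) (e' : 'I_(m + k) -> H) :=
  same_diagram e1 e' /\ (forall l, l \in enum 'I_m -> Q l H e') /\ close H e'.
have Q1_expr : expressible eae_word (b + L.+1) Q1.
  apply: expressible_and; first by apply: expressible_same_diagram => //;
    exact: rshift i.
  apply: expressible_and => //; apply: expressible_forall_in => //.
    exact: rshift i.
  by move=> l; case: (hQ l).
exists (fun (H : graph) (e' : 'I_k -> H) => exists ys : 'I_m -> H,
  Q1 H (catenv ys e')); split.
- apply: (@expressible_le eae_word _ (m + (b + L.+1))) => //; first by lia.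
  exact: expressible_existsn.
- exists xs; split; first by [].
  split=> [l _|z]; first by case: (hQ l).
  rewrite catenv_r ei; case: (boolP (adj x z)) => [xz|]; [right|by left].
  case: (cl x z xK xz) => [zK|[j ->]]; last first.
    by left; exists j; rewrite ?catenv_r ?mem_enum.
  have zx : z <> x by move=> E; move: xz; rewrite E adj_irrefl.
  have [l zC] := CP z zK zx; right; exists l; first by rewrite mem_enum.
  rewrite catenv_l; apply: components_near (CK l) (xsC l) zC _ => y /mapP[j'
    /mapP[j _ ->] ->].
  rewrite catenv_r !inE; apply/negP => /andP[/eqP ne /eK]; exact: ne.
- move=> H e' [ys [diag [hl hc]]].
  apply: (pieces_extend ei eK CK C_inj CP xsC diag).
    by move=> l; have [_ _ h] := hQ l; apply: h; apply: hl; rewrite mem_enum.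
  move=> z iz; case: (hc z) => [|[[j _ ->]|[l _ h]]];
    first by rewrite catenv_r iz.
    left; exists j; exact: catenv_r.
  right; exists l.
  move: h; rewrite catenv_l; congr (near _ _ _ _); rewrite -map_comp.
  by apply: eq_map => j /=; rewrite catenv_r.
Qed.

(** The description of [G] from one pebble only embeds it as an induced subgraph closed under
    adjacency. Requiring every vertex to be joined to that pebble makes the embedding onto;
    connectedness of [G] makes the requirement true in [G]. *)
Lemma elim_sentence b : elim [set: G] b -> (forall x,
  [set: G] = component [set: G] x) ->
  exists p : sentence,
    [/\ qrank p <= (b + L.+1).+1, alternation_number p <= 2 & defines p G].
Proof.
move=> /elim_query[x _ hx] conn.
have [|||Q [expQ QG Qext]] := hx 1 (scons x (@env0 G)) ord0.
- exact: scons0.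
- by move=> j _; rewrite [j]ord1 scons0.
- by left.
have h1 : expressible eae_word (b + L.+1)
    (fun H (e : 'I_1 -> H) => forall z, near [::] L (e ord0) z).
  apply: (@expressible_le ae_word _ L.+1) => //;
    [exact: eae_of_ae|exact: leq_addl|].
  have : expressible ae_word L (fun H (e : 'I_2 -> H) =>
      near [seq e a | a <- [::]] L (e (lift ord0 ord0)) (e ord0)).
    apply: expressible_le (expressible_near _ _ _ _) => //; exact: ae_of_e.
  move=> /expressible_forall; apply: expressible_ext => H e.
  by split=> h z; move: (h z); rewrite scons_lift scons0.
have w s : eae_word s -> eae_word (true :: s) by [].
have [p [p1 p2 p3]] := expressible_exists w (expressible_and expQ h1).
exists p; split=> //.
  by apply/bigmax_leqP_seq => s sp _; apply: alternations_eae; exact: (allP p2).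
split=> [|H].
  apply/p3; exists x; split=> // z; rewrite scons0.
  apply: (@components_near [set: G] [set: G]); rewrite ?inE //.
  by have := components_mem (finset.in_setT x); rewrite -conn.
move=> nGH; apply/negP => /p3[y [Qy hy]]; apply: nGH.
have [f [fx [f_inj f_adj _ _ f_cl]]] := Qext _ _ Qy.
exists f; split; last by move=> u v; rewrite f_adj ?inE.
have injf : injective f by move=> u v; apply: f_inj; rewrite inE.
have surj z : exists u, f u == z.
  have : exists2 u, u \in [set: G] & z = f u.
    apply: (near_inv (P := fun z => exists2 u,
      u \in [set: G] & z = f u)) (hy z) _.
      move=> s t [u _ ->] ut _; case: (f_cl u t _ ut); rewrite ?inE // => -[j ->].
      by exists (scons x (@env0 G) ord0); rewrite ?inE // fx [j]ord1.
    by exists (scons x (@env0 G) ord0); rewrite ?inE // fx.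
  by move=> [u _ ->]; exists u.
exists (fun z => xchoose (surj z)) => [u|z]; last exact/eqP/(xchooseP (surj z)).
by apply: injf; apply/eqP/(xchooseP (surj (f u))).
Qed.

End Main.

Lemma labelling_connected (G : graph) n at_ pos :
  @cycle_labelling G n at_ pos -> forall x,
    [set: G]%SET = component [set: G]%SET x.
Proof.
move=> lab x; apply/setP => y; rewrite !inE; apply/esym/connectP.
have lx := lab_lt lab x; have ly := lab_lt lab y.
exists [seq at_ k | k <- iota (pos x).+1 (pos y + n - pos x)].
  rewrite -{1}(lab_posK lab x); apply: sub_path (at_path lab _ _) => u v uv.
  by rewrite /radj !inE.
rewrite -{1}(lab_posK lab x) at_last subnKC; last lia.
by rewrite (at_mod lab) modnDr modn_small // (lab_posK lab).
Qed.

Lemma D_le (G : graph) k d : definable_with k G d -> D k G <= d.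
Proof.
by move=> h; rewrite /D; case: ex_minnP => m _; apply; apply/asboolP.
Qed.

Lemma D2_bound (R : realType) (G : graph) : outerplanar R G -> hamiltonian G ->
  2 < #|G| /\ D 2 G <= 19 * trunc_log 2 #|G|.-1 + up_log 2 #|G| + 3.
Proof.
move=> outer ham.
have n2 : 2 < #|G|.
  case: ham => c [/andP[_ uc] sc _]; apply: leq_trans sc _.
  by rewrite -(card_uniqP uc) max_card.
split=> //; have [at_ [pos lab]] := hamiltonian_labelling ham.
have noncross a b c d : a < b -> b < c -> c < d -> d < #|G| ->
    adj (at_ a) (at_ c) -> adj (at_ b) (at_ d) -> False.
  exact: noncrossing lab R a b c d outer.
have el := elim_total lab noncross (ltnW (ltnW n2)).
have [p [p1 p2 p3]] := elim_sentence (up_logP #|G| (isT : 1 < 2)) el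
  (labelling_connected lab).
apply: (@leq_trans (qrank p)); first by apply: D_le; exists p.
by apply: leq_trans p1 _; lia.
Qed.

(** * Numerical estimates of logarithms *)

Section Logarithms.
Variable R : realType.
Local Open Scope ring_scope.

Lemma log2_expn k (x : R) : 0 < x -> log2 (x ^+ k) = k%:R * log2 x.
Proof. by move=> x0; rewrite /log2 lnXn // -[_ *+ k]mulr_natl -mulrA. Qed.

Lemma ln2_gt0 : 0 < ln 2 :> R.
Proof. by rewrite ln_gt0 // ltr1n. Qed.

Lemma ler_log2 (x y : R) : 0 < x -> x <= y -> log2 x <= log2 y.
Proof.
move=> x0 xy; rewrite /log2 ler_pM2r ?invr_gt0 ?ln2_gt0 // ler_ln //.
by rewrite posrE (lt_le_trans x0).
Qed.

Lemma ltr_log2 (x y : R) : 0 < x -> x < y -> log2 x < log2 y.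
Proof.
move=> x0 xy; rewrite /log2 ltr_pM2r ?invr_gt0 ?ln2_gt0 // ltr_ln //.
by rewrite posrE (lt_trans x0).
Qed.

Lemma log22 : log2 2 = 1 :> R.
Proof. by rewrite /log2 divff // lt0r_neq0 // ln2_gt0. Qed.

Lemma log2_exp2 k : log2 (2 ^+ k) = k%:R :> R.
Proof. by rewrite log2_expn // log22 mulr1. Qed.

(** From 2^4 < (3/2)^7 and (3/2)^19 <= 2^12. The bounds are chosen so that 12 divided by the
    logarithm lies between 19 and 21. *)
Lemma log2_half3 : 4 / 7 < log2 (3 / 2) :> R /\ log2 (3 / 2) <= 12 / 19 :> R.
Proof.
have p : 0 < 3 / 2 :> R by lra.
have h1 : log2 (2 ^+ 4) < log2 ((3 / 2) ^+ 7) :> R by apply: ltr_log2; lra.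
have h2 : log2 ((3 / 2) ^+ 19) <= log2 (2 ^+ 12) :> R.
  by apply: ler_log2; [apply: exprn_gt0|lra].
move: h1 h2; rewrite !log2_expn // log22 => h1 h2; split; lra.
Qed.

Lemma trunc_log2_le n : (0 < n)%N -> (trunc_log 2 n)%:R <= log2 n%:R :> R.
Proof.
move=> n0; rewrite -log2_exp2.
apply: ler_log2; first exact: exprn_gt0.
by rewrite -natrX ler_nat; exact: trunc_logP.
Qed.

Lemma up_log2_le n : (1 < n)%N -> (up_log 2 n)%:R <= log2 n%:R + 1 :> R.
Proof.
move=> n1; have h : (0 < up_log 2 n)%N by rewrite up_log_gt0.
rewrite -(prednK h) -[leLHS]natr1 lerD2r -log2_exp2.
apply: ler_log2; first exact: exprn_gt0.
rewrite -natrX ler_nat ltnW //; exact: up_log_gtn.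
Qed.
End Logarithms.

Local Open Scope ring_scope.

Theorem theorem4p3 (R : realType) (G : graph)
    (outerplanarG : outerplanar R G) (hamiltonianG : hamiltonian G) :
  let c : R := 12 / log2 (3 / 2) + 1 in
  (D 2 G)%:R < c * log2 #|G|%:R + 9 /\ c < 22.
Proof.
move=> c; have [l1 l2] := log2_half3 R.
have [cl cu] : 19 <= 12 / log2 (3 / 2) :> R /\ 12 / log2 (3 / 2) < 21 :> R.
  have l0 : 0 < log2 (3 / 2) :> R by lra.
  by rewrite ler_pdivlMr // ltr_pdivrMr //; split; lra.
split; last by rewrite /c; lra.
have [n2 hD] := D2_bound outerplanarG hamiltonianG.
have t : (trunc_log 2 #|G|.-1)%:R <= log2 #|G|%:R :> R.
  apply: le_trans (trunc_log2_le R _) _; first lia.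
  by apply: ler_log2; rewrite ?ltr0n ?ler_nat; lia.
have u := up_log2_le R (ltnW n2).
have n0 : 0 <= log2 #|G|%:R :> R.
  by apply: le_trans t.
(* The 4 is the additive 3 of [D2_bound] plus 1 for rounding up in [up_log]; the coefficients add up
   to 20, and [c] is at least 20. *)
apply: (@le_lt_trans _ _ (19 * log2 #|G|%:R + log2 #|G|%:R + 4)); last first.
  have := ler_wpM2r n0 cl; rewrite /c mulrDl mul1r; lra.
have : (D 2 G)%:R <= (19 * trunc_log 2 #|G|.-1 + up_log 2 #|G| + 3)%:R :> R.
  by rewrite ler_nat.
rewrite natrD natrD natrM; lra.
Qed.
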